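(* Let $d\ge 2$ and $r$ be integers satisfying $r>10^7\sqrt{d}\,\log^{2}d$. Then every $n$-vertex $3$-graph with maximum degree $d$ has an equitable $r$-coloring. Moreover, such an $r$-coloring can be found via a randomized algorithm whose expected running time is polynomial in $n$.
   Context: A $3$-graph (3-uniform hypergraph) is a finite hypergraph all of whose edges are sets of exactly $3$ vertices. The degree of a vertex is the number of edges containing it, and the maximum degree is the maximum of the degrees over all vertices. A proper coloring of a hypergraph is a coloring of its vertices with no monochromatic edge. An equitable $r$-coloring of a hypergraph with vertex set $V$ is a proper coloring with $r$ colors in which each color class has size $\lfloor |V|/r\rfloor$ or $\lceil |V|/r\rceil$. Here $\log$ is the natural logarithm and $\log^2 d=(\log d)^2$. *)

(* Defs.v *)
From mathcomp Require Import all_boot all_order all_algebra.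
From mathcomp Require Import all_classical all_reals all_analysis.

Set Implicit Arguments.
Unset Strict Implicit.
Unset Printing Implicit Defensive.

Import Order.TTheory GRing.Theory Num.Theory.

Local Open Scope nat_scope.

(* A hypergraph on the vertex set V is given by its set of edges. *)
Section Hypergraphs.
Variables (V : finType) (E : {set {set V}}).

Definition three_graph : bool := [forall e in E, #|e| == 3].

Definition degree (v : V) : nat := #|[set e in E | v \in e]|.

Definition max_degree : nat := \max_(v : V) degree v.

Definition proper_coloring (r : nat) (f : V -> 'I_r) : Prop :=
  forall e : {set V}, e \in E -> ~ exists c : 'I_r, forall v, v \in e -> f v = c.

(* n %/ r + ~~ (r %| n) is the ceiling of n / r. *)
Definition equitable_coloring (r : nat) (f : V -> 'I_r) : Prop :=
  proper_coloring f /\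
  forall c : 'I_r,
    #|[set v | f v == c]| = #|V| %/ r \/
    #|[set v | f v == c]| = #|V| %/ r + ~~ (r %| #|V|).

End Hypergraphs.

(* Randomized algorithms are programs of a unit-cost random access machine
   with fair coin flips. The memory consists of unboundedly many unbounded
   arrays of naturals; the arrays used by a program are named by literals, so
   there are finitely many of them, and a scalar variable is an array used at a
   single index. The only arithmetic is addition and truncated subtraction:
   unit-cost multiplication would, by repeated squaring, make polynomial time
   on this machine stronger than polynomial time on Turing machines. *)
Definition memory := nat -> nat -> nat.

Inductive expr : Type :=
  | Const of nat
  | Get of nat & expr            (* Get a i is the cell a[i] *)
  | Add of expr & expr
  | Sub of expr & expr.

Inductive cmd : Type :=
  | Skip
  | Put of nat & expr & expr     (* Put a i e : a[i] := e *)
  | Flip of nat & expr           (* Flip a i : a[i] := a fair random bit *)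
  | Seq of cmd & cmd
  | If of expr & cmd & cmd       (* nonzero means true *)
  | While of expr & cmd.

Fixpoint eval (m : memory) (e : expr) : nat :=
  match e with
  | Const k => k
  | Get a i => m a (eval m i)
  | Add e1 e2 => eval m e1 + eval m e2
  | Sub e1 e2 => eval m e1 - eval m e2
  end.

Definition update (m : memory) (a i x : nat) : memory :=
  fun b j => if (b == a) && (j == i) then x else m b j.

(* A configuration is the stack of commands still to be executed, with the
   current memory. *)
Definition config := (seq cmd * memory)%type.

Definition halted (s : config) : bool := nilp s.1.

(* Each step is offered its own coin, which only Flip looks at. A step has
   cost 1; this counts expression evaluation up to a constant factor, since
   the expressions are those of the fixed program. *)
Definition step (s : config) (coin : bool) : config :=
  let: (k, m) := s in
  match k with
  | [::] => s
  | Skip :: k => (k, m)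
  | Put a i e :: k => (k, update m a (eval m i) (eval m e))
  | Flip a i :: k => (k, update m a (eval m i) coin)
  | Seq c1 c2 :: k => (c1 :: c2 :: k, m)
  | If e c1 c2 :: k => ((if eval m e != 0 then c1 else c2) :: k, m)
  | While e c :: k => (if eval m e != 0 then c :: While e c :: k else k, m)
  end.

Definition run (s : config) (coins : seq bool) : config := foldl step s coins.

(* The execution from s with these coins halts after exactly size coins
   steps. *)
Definition halts_exactly (s : config) (coins : seq bool) : bool :=
  halted (run s coins) &&
  all (fun t => ~~ halted (run s (take t coins))) (iota 0 (size coins)).

(* The probability that the running time from s is t: this event is determined
   by the first t coins, which are uniformly distributed. *)
Definition prob_runtime (R : realType) (s : config) (t : nat) : R :=
  (#|[set coins : t.-tuple bool | halts_exactly s coins]|%:R / 2 ^+ t)%R.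

(* The second summand is the contribution of running forever; it vanishes
   exactly when the execution halts almost surely, as +oo * 0 = 0. *)
Definition expected_runtime (R : realType) (s : config) : \bar R :=
  (\sum_(0 <= t <oo) (t%:R * prob_runtime R s t)%:E
   + +oo * (1 - \sum_(0 <= t <oo) (prob_runtime R s t)%:E))%E.

(* An instance (E, r) is written in array 0 as n, r, the number of edges, and
   then the three vertices of each edge in turn; all other cells are 0. *)
Definition encode (n : nat) (E : {set {set 'I_n}}) (r : nat) : seq nat :=
  [:: n, r, #|E| & flatten [seq [seq val v | v <- enum e] | e : {set 'I_n} <- enum E]].

Definition initial (c : cmd) (input : seq nat) : config :=
  ([:: c], fun a i => if a == 0 then nth 0 input i else 0).

(* The color of the vertex v is read from cell v of array 1. *)
Definition outputs (n r : nat) (s : config) (f : 'I_n -> 'I_r) : Prop :=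
  forall v : 'I_n, s.2 1 v = f v.

(* Main.v *)
From mathcomp Require Import all_classical all_reals all_analysis.
Require Import Defs.
From mathcomp Require Import all_boot all_order all_algebra zify ring lra.

(** Let 2^(k+1) <= r < 2^(k+2). If n <= r, every vertex gets its own color. Otherwise
    the vertices walk through a switching network of 2k layers on n positions, driven
    by fair bits, and the color of a vertex is its final position mod r. The walks form
    a permutation, so the coloring is equitable for every choice of the bits. They also
    preserve a partition of the positions into chunks of length below r; hence a
    monochromatic edge has its vertices in three distinct chunks, and its color depends
    on exactly 6k distinct bits. As a vertex reaches a given final position for at most
    2^k of the 4^k bit strings along its walk, at most 8 d 16^k partial assignments that
    make an edge monochromatic involve a given bit.

    The algorithm assigns the bits one at a time and erases the 6k bits of an edge as
    soon as it is completely assigned and monochromatic. A counting argument (entropy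
    compression) bounds the number of unfinished coin sequences of length j by
    3^(2kn) 2^j (1 - 1/(24k))^j once 384 d k <= 4^k, which is where r must be large
    compared with sqrt d log^2 d; so the expected number of rounds is polynomial. *)

Set Implicit Arguments.
Unset Strict Implicit.
Unset Printing Implicit Defensive.
Import Order.TTheory GRing.Theory Num.Theory.

Local Open Scope nat_scope.

(** * Entropy compression *)

(** In a uniformly random equitable coloring every color depends on all the others, so no resampling
    argument applies, while independent colors give unbalanced classes. The network offers balance
    together with local dependence. Its second phase is there because n need not be a multiple of
    2^k: the blocks of the first phase miss the last n mod 2^k positions, and the last 2^k positions
    cover them. Merging this remainder with the last complete block gives a chunk of length below
    2^(k+1) <= r. The count 8 d 16^k is the product of 2 * 4^k walks through a given switch, 4 d
    ordered pairs for the rest of the edge, and 2^k * 2^k bit strings that bring this pair to the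
    color of the first vertex. Erasing 6k bits weighs about 64^k against this count. Up to constants
    and a factor k the condition is therefore d <= 4^k, where 4^k is of order r^2; this is the
    origin of sqrt d. *)

Section PartialAssignments.
Variable X : finType.

Definition assignment := {ffun X -> option bool}.

Implicit Types (s p : assignment) (x : X) (b : bool).

Definition support s : {set X} := [set x | s x != None].

Definition subassignment p s := [forall x, (p x != None) ==> (p x == s x)].

Definition assign s x b : assignment := [ffun z => if z == x then Some b else s z].

Definition erase s (A : {set X}) : assignment := [ffun z => if z \in A then None else s z].

Lemma support_assign s x b : support (assign s x b) = x |: support s.
Proof. by apply/setP=> z; rewrite !inE ffunE; case: (z == x). Qed.

Lemma support_erase s A : support (erase s A) = support s :\: A.
Proof. by apply/setP=> z; rewrite !inE ffunE; case: (z \in A); rewrite ?andbF. Qed.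

Lemma subassignmentP p s :
  reflect (forall x, p x != None -> p x = s x) (subassignment p s).
Proof.
apply: (iffP forallP) => H x; first by move/(implyP (H x))/eqP.
by apply/implyP=> /H ->.
Qed.

Lemma support_subassignment p s : subassignment p s -> support p \subset support s.
Proof.
move/subassignmentP=> H; apply/subsetP=> x; rewrite !inE => px.
by rewrite -H.
Qed.

(* The search always treats a variable that depends only on which variables
   are assigned, and [choice] returns a pattern to be erased. *)
Variable patterns : {set assignment}.
Variable select : {set X} -> X.
Variable choice : assignment -> option assignment.
Hypothesis selectP : forall A, A != [set: X] -> select A \notin A.
Hypothesis choice_some : forall s p, choice s = Some p -> p \in patterns /\ subassignment p s.
Hypothesis choice_none : forall s, choice s = None ->
  forall p, p \in patterns -> ~~ subassignment p s.

Definition complete_assignment s := support s == [set: X].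

Definition pattern_free s := [forall p in patterns, ~~ subassignment p s].

Definition prune s := if choice s is Some p then erase s (support p) else s.

Definition search s b := prune (assign s (select (support s)) b).

(** The number of coin sequences of length [j] during which the search from [s] never becomes
    complete. Completeness is tested before a coin is used, so a search that ends exactly with the
    last coin is not counted. *)
Fixpoint unfinished j s : nat :=
  if complete_assignment s then 0
  else if j is j'.+1 then unfinished j' (search s false) + unfinished j' (search s true)
  else 1.

Lemma pattern_freeP s :
  reflect (forall p, p \in patterns -> ~~ subassignment p s) (pattern_free s).
Proof. by apply: (iffP forall_inP). Qed.

(** A pattern that avoids [x] would already be contained in [s]. *)
Lemma pattern_through_new s x b p : pattern_free s ->
  p \in patterns -> subassignment p (assign s x b) -> p x != None.
Proof.
move/pattern_freeP=> sf pP /subassignmentP ps; apply/negP=> /eqP px.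
have /negP := sf p pP; apply; apply/subassignmentP=> z pz; rewrite ps // ffunE.
by case: eqP => // zx; rewrite zx px in pz.
Qed.

(** An erased pattern contains the new variable, so what remains is part of the old [s]: one erasure
    restores the invariant even if several patterns were completed at once. *)
Lemma search_pattern_free s b : pattern_free s -> pattern_free (search s b).
Proof.
move=> sf; rewrite /search /prune; set x := select _.
case E: (choice _) => [p|]; last first.
  by apply/pattern_freeP; apply: choice_none.
have [pP ps] := choice_some E.
have px := pattern_through_new sf pP ps.
move/pattern_freeP: sf => sf.
apply/pattern_freeP=> q qP; apply/negP=> /subassignmentP qs.
have /negP := sf q qP; apply; apply/subassignmentP=> z qz.
have H := qs z qz; move: qz; rewrite H !ffunE.
by case: ifP => //; have [->|] := eqVneq z x; rewrite ?inE ?px.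
Qed.

Section Counting.
Variables (F : realFieldType) (y lam : F) (L N : nat).
Hypothesis pattern_size : forall p, p \in patterns -> #|support p| = L.
Hypothesis patterns_through : forall x, #|[set p in patterns | p x != None]| <= N.
Hypothesis y1 : (1 <= y)%R.
(** Each assigned variable has weight [y] in the potential. A step adds one variable, and an erasure
    removes [L]; divided by y^L, the inequality says that all outcomes together multiply the
    potential by at most [lam]. *)
Hypothesis growth : (N%:R * y <= (lam - y) * y ^+ L)%R.

Let lam0 : (0 <= lam)%R.
Proof.
have y0 : (0 <= y)%R by apply: le_trans y1.
have : (0 <= (lam - y) * y ^+ L)%R by apply: le_trans growth; rewrite mulr_ge0.
rewrite pmulr_lge0 ?exprn_gt0 ?(lt_le_trans _ y1) // subr_ge0.
exact: le_trans.
Qed.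

(* An assignment can be recovered from the outcome of a step together with the
   erased pattern, if any; summing over assignments with a common support and
   over patterns through the selected variable gives the recursion
   [lam = y + N y^(1-L)] for the growth rate. *)
Lemma unfinished_sum j (A : {set X}) (Sg : {set assignment}) :
  (forall s, s \in Sg -> support s = A /\ pattern_free s) ->
  (\sum_(s in Sg) (unfinished j s)%:R <= #|{: assignment}|%:R * lam ^+ j * y ^+ #|A| :> F)%R.
Proof.
have y0 : (0 < y)%R by apply: lt_le_trans y1.
elim: j A Sg => [|j IH] A Sg HS.
  apply: (@le_trans _ _ (\sum_(s in Sg) 1)%R).
    by apply: ler_sum => s _ /=; case: ifP.
  rewrite sumr_const expr0 mulr1 -[X in (X <= _)%R]mulr1.
  by rewrite ler_pM // ?ler_nat ?max_card // exprn_ege1.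
have rhs0 : (0 <= #|{: assignment}|%:R * lam ^+ j.+1 * y ^+ #|A|)%R.
  by rewrite !mulr_ge0 // ?exprn_ge0 ?(ltW y0).
have [AT|AT] := eqVneq A [set: X].
  rewrite big1 // => s /HS[sA _] /=.
  by rewrite /complete_assignment sA AT eqxx.
set x := select A.
have xA : x \notin A by apply: selectP.
have step s : s \in Sg -> unfinished j.+1 s =
   unfinished j (prune (assign s x false)) + unfinished j (prune (assign s x true)).
  by move=> /HS[sA _] /=; rewrite /complete_assignment sA (negbTE AT) /search sA.
(* All members of [Sg] have the support [A], which misses [x], so pairs of an assignment and a bit
   correspond bijectively to [D]. *)
pose D : {set assignment} := [set t | [exists s in Sg, [exists b, t == assign s x b]]].
have sumD : (\sum_(s in Sg) (unfinished j.+1 s)%:R = \sum_(t in D) (unfinished j (prune t))%:R :> F)%R.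
  transitivity (\sum_(sb in setX Sg [set: bool]) (unfinished j (prune (assign sb.1 x sb.2)))%:R : F)%R.
    rewrite (eq_bigl (fun sb : assignment * bool => (sb.1 \in Sg) && (sb.2 \in [set: bool]))); last first.
      by move=> [s b]; rewrite in_setX.
    rewrite -(pair_big_dep (mem Sg) (fun s => mem [set: bool]) (fun s b => (unfinished j (prune (assign s x b)))%:R%R)).
    apply: eq_bigr => s sS; rewrite step // natrD addrC.
    rewrite (eq_bigl predT) ?big_bool //.
    by move=> b; rewrite /= in_setT.
  have inj : {in setX Sg [set: bool] &, injective (fun sb : assignment * bool => assign sb.1 x sb.2)}.
    move=> [s b] [s' b'] /setXP[/= sS _] /setXP[/= s'S _] /= E.
    have Eb : b = b'.
      by move/ffunP: E => /(_ x); rewrite !ffunE eqxx => -[].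
    congr pair => //; apply/ffunP=> z.
    move/ffunP: E => /(_ z); rewrite !ffunE; case: eqP => // -> _.
    have [sA _] := HS _ sS; have [s'A _] := HS _ s'S.
    have : x \notin support s by rewrite sA.
    have : x \notin support s' by rewrite s'A.
    by rewrite !inE !negbK => /eqP -> /eqP ->.
  have -> : D = [set assign sb.1 x sb.2 | sb in setX Sg [set: bool]].
    apply/setP=> t; rewrite inE; apply/exists_inP/imsetP.
      by move=> [s sS /existsP[b /eqP ->]]; exists (s, b) => //; rewrite in_setX sS inE.
    move=> [[s b] /setXP[/= sS _] ->]; exists s => //.
    by apply/existsP; exists b.
  by rewrite (big_imset _ inj).
have DP t : t \in D -> support t = x |: A.
  rewrite inE => /exists_inP[s /HS[sA _] /existsP[b /eqP ->]].
  by rewrite support_assign sA.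
have cA : #|x |: A| = #|A|.+1 by rewrite cardsU1 xA.
pose Dn := [set t in D | choice t == None].
pose Dp p := [set t in D | choice t == Some p].
pose Px := [set p in patterns | p x != None].
have good t : t \in D -> pattern_free (prune t).
  rewrite inE => /exists_inP[s /HS[sA sf] /existsP[b /eqP ->]].
  by have := search_pattern_free b sf; rewrite /search sA.
have boundN : (\sum_(t in Dn) (unfinished j (prune t))%:R <= #|{: assignment}|%:R * lam ^+ j * y ^+ #|A|.+1 :> F)%R.
  rewrite -cA (eq_bigr (fun t => (unfinished j t)%:R%R)); last first.
    by move=> t; rewrite inE /prune => /andP[_ /eqP ->].
  apply: IH => t; rewrite inE => /andP[tD /eqP ct]; split; first exact: DP.
  by have := good _ tD; rewrite /prune ct.
have boundP p : p \in Px -> (\sum_(t in Dp p) (unfinished j (prune t))%:R <=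
    #|{: assignment}|%:R * lam ^+ j * y ^+ #|A| * (y / y ^+ L) :> F)%R.
  rewrite inE => /andP[pP px].
  have [->|[t0 t0D]] := set_0Vmem (Dp p).
    by rewrite big_set0 !mulr_ge0 ?invr_ge0 ?exprn_ge0 ?(ltW y0).
  have psub t : t \in Dp p -> subassignment p t.
    by rewrite inE => /andP[_ /eqP/choice_some[]].
  (* On its support [p] prescribes the values of [t], and elsewhere nothing is erased. *)
  have inj : {in Dp p &, injective (fun t => erase t (support p))}.
    move=> t t' tD t'D E; apply/ffunP=> z.
    have [pz|pz] := boolP (p z != None).
      by rewrite -(subassignmentP _ _ (psub _ tD)) // -(subassignmentP _ _ (psub _ t'D)).
    by move/ffunP: E => /(_ z); rewrite !ffunE inE (negbTE pz).
  rewrite (eq_bigr (fun t => (unfinished j (erase t (support p)))%:R%R)); last first.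
    by move=> t; rewrite inE /prune => /andP[_ /eqP ->].
  rewrite -(big_imset (fun t => (unfinished j t)%:R%R) inj) /=.
  have subp : support p \subset x |: A.
    by move: t0D (psub _ t0D); rewrite inE => /andP[/DP <- _]; apply: support_subassignment.
  apply: (@le_trans _ _ (#|{: assignment}|%:R * lam ^+ j * y ^+ #|(x |: A) :\: support p|)%R).
    apply: IH => _ /imsetP[t tD ->]; move: (tD); rewrite inE => /andP[tD' /eqP ct].
    rewrite support_erase (DP _ tD'); split=> //.
    by have := good _ tD'; rewrite /prune ct.
  rewrite cardsD (setIidPr subp) cA pattern_size //.
  rewrite -[leRHS]mulrA ler_wpM2l ?mulr_ge0 ?exprn_ge0 //.
  (* This makes the exponent #|A|.+1 - L a genuine difference. *)
  have LA : L <= #|A|.+1 by rewrite -cA -(pattern_size pP) subset_leq_card.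
  by rewrite mulrA -exprSr expfB_cond ?subnn // (gt_eqF y0).
have split : (\sum_(t in D) (unfinished j (prune t))%:R <=
    \sum_(t in Dn) (unfinished j (prune t))%:R +
    \sum_(p in Px) \sum_(t in Dp p) (unfinished j (prune t))%:R :> F)%R.
  rewrite (bigID (fun t => choice t == None)) /=.
  apply: lerD.
    by rewrite [leRHS](eq_bigl (fun t => (t \in D) && (choice t == None))) // => t; rewrite in_set.
  rewrite (exchange_big_dep (mem D)) /= => [|p t _]; last by rewrite in_set => /andP[].
  rewrite big_mkcondr; apply: ler_sum => t tD /=.
  case Ct: (choice t) => [p|] //=; last by apply: sumr_ge0.
  (* Only patterns through [x] can have been completed, which limits the sum to [N] terms. *)
  have pPx : p \in Px.
    have [pP pt] := choice_some Ct; rewrite inE pP /=.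
    move: tD; rewrite inE => /exists_inP[s /HS[sA sf] /existsP[b /eqP Et]].
    by rewrite Et in pt; apply: pattern_through_new pt.
  rewrite (bigD1 p) /=; last by rewrite pPx in_set tD Ct eqxx.
  by rewrite lerDl sumr_ge0.
rewrite sumD; apply: (le_trans split).
apply: (@le_trans _ _ (#|{: assignment}|%:R * lam ^+ j * y ^+ #|A| * (y + N%:R * (y / y ^+ L))))%R.
  rewrite mulrDr; apply: lerD; first by rewrite -mulrA -exprSr.
  apply: le_trans (ler_sum _ boundP) _.
  rewrite sumr_const -[leLHS]mulr_natr -[leLHS]mulrA [(y / _ * _)%R]mulrC.
  rewrite ler_wpM2l ?mulr_ge0 ?exprn_ge0 ?(ltW y0) //.
  by rewrite ler_wpM2r ?divr_ge0 ?exprn_ge0 ?(ltW y0) // ler_nat patterns_through.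
rewrite exprSr -!mulrA !ler_wpM2l ?exprn_ge0 //.
rewrite [leRHS]mulrC ler_wpM2l ?exprn_ge0 ?(ltW y0) //.
by rewrite addrC -lerBrDr mulrA ler_pdivrMr ?exprn_gt0.
Qed.

Definition empty_assignment : assignment := [ffun=> None].

Lemma unfinished_bound j : pattern_free empty_assignment ->
  ((unfinished j empty_assignment)%:R <= #|{: assignment}|%:R * lam ^+ j :> F)%R.
Proof.
move=> ef; have := @unfinished_sum j set0 [set empty_assignment].
rewrite big_set1 cards0 expr0 mulr1; apply=> s; rewrite inE => /eqP ->; split=> //.
by apply/setP=> z; rewrite !inE ffunE eqxx.
Qed.

End Counting.
End PartialAssignments.

(** * The switching network *)

Definition half k := 2 ^ k.-1.

Section Shuffle.
Variable k : nat.
Hypothesis k0 : 0 < k.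

(** Rotates the k-bit word [x] to the left and adds [b] modulo 2 to the bit that wraps around, as in
    a shuffle-exchange network. It is written with additions and subtractions because the machine
    has no others. *)
Definition shuffle (b : bool) (x : nat) : nat :=
  x + x - (if x < half k then 0 else 2 ^ k) + (b (+) (half k <= x)).

Definition fold_half (x : nat) : nat := if half k <= x then x - half k else x.

Lemma double_half : 2 ^ k = half k + half k.
Proof. by rewrite /half -{1}(prednK k0) expnS mul2n addnn. Qed.

Lemma shuffleE b x : shuffle b x = fold_half x + fold_half x + (b (+) (half k <= x)).
Proof.
by rewrite /shuffle /fold_half double_half ltnNge; case: leqP => H /=; lia.
Qed.

Lemma fold_half_lt x : x < 2 ^ k -> fold_half x < half k.
Proof. by rewrite /fold_half double_half; case: (leqP (half k) x); lia. Qed.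

Lemma shuffle_lt b x : x < 2 ^ k -> shuffle b x < 2 ^ k.
Proof.
move=> /fold_half_lt; rewrite shuffleE double_half; case: (b (+) _) => /=; lia.
Qed.

Lemma shuffle_fold b b' x x' : shuffle b x = shuffle b' x' -> fold_half x = fold_half x'.
Proof. rewrite !shuffleE; case: (b (+) _); case: (b' (+) _) => /=; lia. Qed.

Lemma shuffle_bit b b' x x' : shuffle b x = shuffle b' x' ->
  b (+) (half k <= x) = b' (+) (half k <= x').
Proof. rewrite !shuffleE; case: (b (+) _); case: (b' (+) _) => //=; lia. Qed.

Lemma shuffle_inj b x x' : shuffle b x = shuffle b x' -> x = x'.
Proof.
move=> E; have := shuffle_fold E; have := shuffle_bit E; rewrite /fold_half.
by case: leqP => Hx; case: leqP => Hx'; case: b {E} => //= _; lia.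
Qed.

Fixpoint shuffles (g : nat -> bool) (x i : nat) : nat :=
  if i is i'.+1 then shuffle (g i') (shuffles g x i') else x.

Lemma shuffles_lt g x i : x < 2 ^ k -> shuffles g x i < 2 ^ k.
Proof. by move=> Hx; elim: i => //= i IH; apply: shuffle_lt. Qed.

(* After i shuffles the i low bits of the position record the i choices made. *)
Lemma shuffles_bits g g' x i : i <= k ->
  shuffles g x i = shuffles g' x i %[mod 2 ^ i] -> forall j, j < i -> g j = g' j.
Proof.
elim: i => // i IH ik /=; set s := shuffles g x i; set s' := shuffles g' x i.
rewrite !shuffleE => E.
have Eb : g i (+) (half k <= s) = g' i (+) (half k <= s').
  have : odd (fold_half s + fold_half s + (g i (+) (half k <= s))) =
         odd (fold_half s' + fold_half s' + (g' i (+) (half k <= s'))).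
    move: E; rewrite expnS mul2n -muln2 => E.
    have odd_mod z : odd (z %% (2 ^ i * 2)) = odd z.
      by rewrite [in RHS](divn_eq z (2 ^ i * 2)) oddD mulnA oddM andbF.
    by rewrite -odd_mod E odd_mod.
  by rewrite !oddD !addbb /= !oddb.
move: E; rewrite Eb => /eqP; rewrite eqn_modDr !addnn -!mul2n expnS.
rewrite -!muln_modr eqn_pmul2l // => /eqP E.
(* Since i < k, the modulus 2^i divides [half k], so dropping the top bit keeps the residue. *)
have fold_mod z : z %% 2 ^ i = fold_half z %% 2 ^ i.
  rewrite /fold_half; case: leqP => // Hz.
  rewrite -{1}(subnK Hz) -modnDmr (_ : half k %% 2 ^ i = 0) ?addn0 //.
  by apply/eqP; rewrite -/(dvdn _ _) dvdn_exp2l // -ltnS prednK.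
have IHi : forall j, j < i -> g j = g' j by apply: IH; [exact: ltnW | rewrite fold_mod E -fold_mod].
(* Equal earlier bits lead to the same position, hence to the same top bit, which can then be
   cancelled. *)
have Es : s = s'.
  rewrite /s /s'; move: {E Eb s s' ik IH fold_mod} IHi; elim: i => //= i IH Hi.
  by rewrite Hi // IH // => j ji; apply: Hi; apply: ltnW.
move=> j; rewrite ltnS leq_eqVlt => /predU1P[->|]; last exact: IHi.
by move: Eb; rewrite Es => /addIb.
Qed.

Lemma shuffles_inj g g' x :
  shuffles g x k = shuffles g' x k -> forall j, j < k -> g j = g' j.
Proof. by move=> E; apply: (@shuffles_bits _ _ x) => //; rewrite E. Qed.

End Shuffle.

Section Network.
Variables (n k : nat).
Hypothesis k0 : 0 < k.
Hypothesis kn : 2 ^ k <= n.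

(* In layers l < k every aligned block of 2^k positions is shuffled; in the k
   later layers the last 2^k positions are. A position outside these blocks has a
   switch of its own that has no effect. *)
Definition active l p := if l < k then p - p %% 2 ^ k + 2 ^ k <= n else n <= p + 2 ^ k.
Definition offset l p := if l < k then p %% 2 ^ k else p + 2 ^ k - n.
Definition switch l p :=
  if active l p then (if half k <= offset l p then p - half k else p) else p.
Definition target (b : bool) l p :=
  if active l p then
    p + offset l p - (if offset l p < half k then 0 else 2 ^ k) + (b (+) (half k <= offset l p))
  else p.

(** The remainder after the last complete block is merged with that block, so the last 2^k positions
    lie in one chunk and the second phase preserves chunks too. *)
Definition chunk p := minn (p %/ 2 ^ k) (n %/ 2 ^ k).-1.

Let sz0 : 0 < 2 ^ k. Proof. by rewrite expn_gt0. Qed.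

(** Lets both kinds of layers be treated alike: [B] is the start of the shuffled block, an aligned
    one in the first [k] layers and n - 2^k afterwards. *)
Lemma active_block l p : p < n -> active l p ->
  exists B, [/\ p = B + offset l p, offset l p < 2 ^ k, B + 2 ^ k <= n &
    forall y, y < 2 ^ k -> [/\ active l (B + y), offset l (B + y) = y & chunk (B + y) = chunk p]].
Proof.
move=> pn; rewrite /active /offset; case: ltnP => lk Hp.
  exists (p - p %% 2 ^ k); split => //; first by rewrite subnK // leq_mod.
    by rewrite ltn_pmod.
  move=> y ysz; set c := p %/ 2 ^ k.
  have EB : p - p %% 2 ^ k = c * 2 ^ k by rewrite {1}(divn_eq p (2 ^ k)) addnK.
  rewrite EB in Hp *.
  have Ey : (c * 2 ^ k + y) %% 2 ^ k = y by rewrite modnMDl modn_small.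
  rewrite Ey addnK; split=> //.
  by rewrite /chunk divnMDl // (divn_small ysz) addn0.
exists (n - 2 ^ k); split; try lia.
move=> y ysz; split; try lia.
have H q : n <= q + 2 ^ k -> chunk q = (n %/ 2 ^ k).-1.
  move=> nq; apply/minn_idPr.
  by have := leq_div2r (2 ^ k) nq; rewrite divnDr ?dvdnn // divnn sz0 -subn1 leq_subLR addnC.
by rewrite !H //; lia.
Qed.

Lemma target_active l p b : p < n -> active l p ->
  exists B x, [/\ p = B + x, x < 2 ^ k, B + 2 ^ k <= n,
     target b l p = B + shuffle k b x /\ switch l p = B + fold_half k x &
     forall y, y < 2 ^ k -> [/\ active l (B + y), offset l (B + y) = y & chunk (B + y) = chunk p]].
Proof.
move=> pn ap; have [B [Ep osz Bn H]] := active_block pn ap.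
exists B, (offset l p); split=> //; split.
  rewrite /target ap {1}Ep /shuffle double_half //.
  case: ltnP => H1 /=; rewrite ?subn0 ?addnA //; lia.
by rewrite /switch ap /fold_half; case: leqP => // H1; lia.
Qed.

Lemma target_inactive l p b : ~~ active l p -> target b l p = p.
Proof. by rewrite /target => /negbTE ->. Qed.

Lemma switch_inactive l p : ~~ active l p -> switch l p = p.
Proof. by rewrite /switch => /negbTE ->. Qed.

Lemma target_lt b l p : p < n -> target b l p < n.
Proof.
move=> pn; have [ap|ap] := boolP (active l p); last by rewrite target_inactive.
have [B [x [_ Hx Bn [-> _] _]]] := target_active b pn ap.
by have := shuffle_lt k0 b Hx; lia.
Qed.

Lemma switch_le l p : switch l p <= p.
Proof. by rewrite /switch; case: ifP => // _; case: ifP => // _; lia. Qed.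

Lemma switch_lt l p : p < n -> switch l p < n.
Proof. exact/leq_ltn_trans/switch_le. Qed.

Lemma target_isactive b l p : p < n -> active l (target b l p) = active l p.
Proof.
move=> pn; have [ap|ap] := boolP (active l p); last by rewrite target_inactive // (negbTE ap).
have [B [x [_ Hx Bn [-> _] H]]] := target_active b pn ap.
by have [->] := H _ (shuffle_lt k0 b Hx).
Qed.

Lemma target_chunk b l p : p < n -> chunk (target b l p) = chunk p.
Proof.
move=> pn; have [ap|ap] := boolP (active l p); last by rewrite target_inactive.
have [B [x [_ Hx Bn [-> _] H]]] := target_active b pn ap.
by have [] := H _ (shuffle_lt k0 b Hx).
Qed.

Lemma switch_chunk l p : p < n -> chunk (switch l p) = chunk p.
Proof.
move=> pn; have [ap|ap] := boolP (active l p); last by rewrite switch_inactive.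
have [B [x [_ Hx Bn [_ ->] H]]] := target_active true pn ap.
have [|//] := H (fold_half k x).
by have := fold_half_lt k0 Hx; rewrite (double_half k0); lia.
Qed.

(** Blocks are preserved, and a shuffle with a fixed bit is injective. Vertices in one switch read
    the same bit, so the first conclusion will supply the premise of the second and each layer acts
    as a permutation. *)
Lemma target_eq b b' l p p' : p < n -> p' < n -> target b l p = target b' l p' ->
  [/\ switch l p = switch l p' & b = b' -> p = p'].
Proof.
move=> pn pn' E.
have Ea : active l p = active l p' by rewrite -(target_isactive b l pn) E target_isactive.
have [ap|ap] := boolP (active l p); last first.
  rewrite !target_inactive -?Ea // in E.
  by rewrite E.
have ap' : active l p' by rewrite -Ea.
have [B [x [Ep Hx Bn [Et Es] H]]] := target_active b pn ap.
have [B' [x' [Ep' Hx' Bn' [Et' Es'] H']]] := target_active b' pn' ap'.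
rewrite Et Et' in E.
have [_ E1 _] := H _ (shuffle_lt k0 b Hx).
have [_ E1' _] := H' _ (shuffle_lt k0 b' Hx').
rewrite E E1' in E1.
have EB : B = B' by lia.
split; first by rewrite Es Es' EB (shuffle_fold k0 (esym E1)).
by move=> Eb; move: E1; rewrite Eb Ep Ep' EB => /(shuffle_inj k0) ->.
Qed.

Lemma switch_fiber l p : p < n -> p = switch l p \/ p = switch l p + half k.
Proof.
move=> pn; have [ap|ap] := boolP (active l p); last by left; rewrite switch_inactive.
have [B [x [Ep Hx Bn [_ ->] H]]] := target_active true pn ap.
by rewrite Ep /fold_half; case: leqP => Hh; [right; lia | left].
Qed.

(** A chunk has fewer than 2^(k+1) <= r positions, so inside a chunk the color determines the
    position. *)
Lemma chunk_mod r p p' : 2 ^ k.+1 <= r -> p < n -> p' < n ->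
  chunk p = chunk p' -> p = p' %[mod r] -> p = p'.
Proof.
move=> kr pn pn' Ec.
wlog pp : p p' pn pn' Ec / p <= p'.
  move=> W; case/orP: (leq_total p p') => H E; first exact: W.
  by apply/esym; apply: W.
move/eqP; rewrite eq_sym eqn_mod_dvd // => /dvdnP[q Eq].
have : p' - p < r.
  apply: leq_trans kr; rewrite expnS mul2n -addnn.
  move: Ec; rewrite /chunk.
  have := divn_eq p (2 ^ k); have := divn_eq p' (2 ^ k).
  have := ltn_pmod p sz0; have := ltn_pmod p' sz0.
  have := divn_eq n (2 ^ k); have := ltn_pmod n sz0.
  have n1 : 0 < n %/ 2 ^ k by rewrite divn_gt0.
  have : p' %/ 2 ^ k <= n %/ 2 ^ k by rewrite leq_div2r // ltnW.
  have : p %/ 2 ^ k <= n %/ 2 ^ k by rewrite leq_div2r // ltnW.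
  set a := p %/ _; set a' := p' %/ _; set c := n %/ _ in n1 *.
  move=> ac ac' Hn En Hp' Hp Ep' Ep Em.
  (* Either one aligned block contains both positions, or both lie in the last chunk, between
     [c.-1 * 2 ^ k] and [n]. *)
  have [Ea|Ea] : a = a' \/ (c.-1 <= a /\ a <= c) by lia.
    by rewrite Ea in Ep; lia.
  have {}Em : a' <= c.-1 -> a' = c.-1 by lia.
  have cp : c.-1 * 2 ^ k <= p by rewrite Ep (leq_trans _ (leq_addr _ _)) // leq_mul2r (proj1 Ea) orbT.
  have : n = c.-1 * 2 ^ k + 2 ^ k + n %% 2 ^ k.
    by rewrite {1}En -{1}(prednK n1) mulSn [2 ^ k + _]addnC.
  lia.
rewrite Eq; case: q Eq => [|q] Eq; first by lia.
by rewrite ltnNge mulSn leq_addr.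
Qed.

Fixpoint position (g : nat -> bool) v l : nat :=
  if l is l'.+1 then target (g l') l' (position g v l') else v.

Lemma position_lt g v l : v < n -> position g v l < n.
Proof. by move=> vn; elim: l => //= l IH; apply: target_lt. Qed.

Lemma position_chunk g v l : v < n -> chunk (position g v l) = chunk v.
Proof. by move=> vn; elim: l => //= l IH; rewrite target_chunk // position_lt. Qed.

Lemma position_inj g v v' l : v < n -> v' < n -> position g v l = position g v' l -> v = v'.
Proof.
move=> vn v'n; elim: l => //= l IH E; apply: IH.
by have [_ ->] := target_eq (position_lt g l vn) (position_lt g l v'n) E.
Qed.

Lemma eq_position g g' v l : (forall j, j < l -> g j = g' j) -> position g v l = position g' v l.
Proof.
elim: l => //= l IH H; rewrite H // IH // => j jl.
by apply: H; apply: ltnW.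
Qed.

(** Within a phase the block of a vertex does not change, so its moves are plain shuffles of the
    offset. *)
Lemma phase_shuffles g v l0 B x : l0 = 0 \/ l0 = k ->
  (forall y, y < 2 ^ k -> active l0 (B + y) /\ offset l0 (B + y) = y) -> x < 2 ^ k ->
  position g v l0 = B + x ->
  forall i, i <= k -> position g v (l0 + i) = B + shuffles k (fun j => g (l0 + j)) x i.
Proof.
move=> Hl H Hx E; elim=> [|i IH] ik; first by rewrite addn0.
rewrite addnS /= IH ?(ltnW ik) //.
set s := shuffles _ _ _ _.
have ssz : s < 2 ^ k by apply: shuffles_lt.
have [Ha Ho] := H _ ssz.
have EQ : (l0 + i < k) = (l0 < k) by case: Hl ik => -> ik; rewrite ?add0n ?ik ?k0 // ltnn ltnNge leq_addr.
have Ea : active (l0 + i) (B + s) by rewrite /active EQ.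
have Eo : offset (l0 + i) (B + s) = s by rewrite /offset EQ.
rewrite /target Ea Eo /shuffle double_half //.
by case: ltnP => Hs /=; rewrite ?subn0 ?addnA //; lia.
Qed.

Lemma phase_bits g g' v v' l0 : l0 = 0 \/ l0 = k -> v < n ->
  position g v l0 = position g' v' l0 -> active l0 (position g v l0) ->
  position g v (l0 + k) = position g' v' (l0 + k) -> forall j, j < k -> g (l0 + j) = g' (l0 + j).
Proof.
move=> Hl vn E0 ap E.
have [B [x [Ep Hx _ _ H]]] := target_active true (position_lt g l0 vn) ap.
have {}H y : y < 2 ^ k -> active l0 (B + y) /\ offset l0 (B + y) = y by case/H.
move: E; rewrite (phase_shuffles Hl H Hx Ep) // (phase_shuffles Hl H Hx) -?E0 //.
by move/addnI/shuffles_inj => /(_ k0) /= Ej j /Ej.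
Qed.

Lemma phase_inactive g v l0 : l0 = 0 \/ l0 = k -> v < n ->
  active l0 (position g v (l0 + k)) = active l0 (position g v l0) /\
  (~~ active l0 (position g v l0) -> position g v (l0 + k) = position g v l0).
Proof.
move=> Hl vn.
suff H i : i <= k -> active l0 (position g v (l0 + i)) = active l0 (position g v l0) /\
  (~~ active l0 (position g v l0) -> position g v (l0 + i) = position g v l0) by exact: H.
elim: i => [|i IH] ik; first by rewrite addn0.
rewrite addnS /=.
have EQ : (l0 + i < k) = (l0 < k).
  by case: Hl ik => -> ik; rewrite ?add0n ?ik ?k0 // ltnn ltnNge leq_addr.
have Ea p : active (l0 + i) p = active l0 p by rewrite /active EQ.
have [I1 I2] := IH (ltnW ik).
rewrite -!Ea target_isactive ?position_lt // !Ea I1; split=> // na.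
by rewrite target_inactive ?Ea ?I1 // I2.
Qed.

Local Notation L := (k + k).

(* Of the two phases at most one can be predicted from the other and the final position. *)
Lemma position_bits v (q : nat) : v < n ->
  #|[set g : L.-tuple bool | position (nth false g) v L == q]| <= 2 ^ k.
Proof.
move=> vn; set G := [set _ | _].
have Gpos (g : L.-tuple bool) : g \in G -> position (nth false g) v L = q by rewrite inE => /eqP.
suff [f finj] : exists f : L.-tuple bool -> k.-tuple bool, {in G &, injective f}.
  rewrite -(card_in_imset finj) (leq_trans (max_card _)) // card_tuple card_bool //.
have tk (g : L.-tuple bool) : size (take k g) == k by rewrite size_takel ?size_tuple ?leq_addr.
have dk (g : L.-tuple bool) : size (drop k g) == k by rewrite size_drop size_tuple addnK.
have ext (g g' : L.-tuple bool) : (forall j, j < k -> nth false g j = nth false g' j) ->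
   (forall j, j < k -> nth false g (k + j) = nth false g' (k + j)) -> g = g'.
  move=> H1 H2; apply/val_inj; apply: (@eq_from_nth _ false); first by rewrite !size_tuple.
  move=> i; rewrite size_tuple => iL; have [ik|ik] := ltnP i k; first exact: H1.
  by rewrite -(subnKC ik) H2 // -(ltn_add2l k) subnKC.
(* If the second phase acts at [q], the first [k] bits fix where that phase starts, and its start
   and end fix the other [k] bits. *)
have [aq|aq] := boolP (active k q).
  exists (fun g => Tuple (tk g)) => g g' gG g'G [] E.
  have E1 j : j < k -> nth false g j = nth false g' j.
    by move=> jk; rewrite -(nth_take _ jk) E nth_take.
  apply: ext => // j jk.
  have Ep : position (nth false g) v k = position (nth false g') v k by apply: eq_position.
  apply: (phase_bits (or_intror (erefl k)) vn Ep) => //; last first.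
    by rewrite (Gpos g) // (Gpos g').
  have [<- _] := phase_inactive (nth false g) (or_intror (erefl k)) vn.
  by rewrite (Gpos g gG).
(* Otherwise the vertex is at [q] already after [k] layers: the first [k] bits follow from [v] and
   [q], and the last [k] serve as the code. *)
exists (fun g => Tuple (dk g)) => g g' gG g'G [] E.
have E1 j : j < k -> nth false g (k + j) = nth false g' (k + j).
  by rewrite -!nth_drop E.
have qk h : h \in G -> position (nth false h) v k = q.
  move=> hG; have [Ea Ep] := phase_inactive (nth false h) (or_intror (erefl k)) vn.
  by rewrite -Ep -?Ea (Gpos h).
apply: ext => // j jk.
apply: (@phase_bits (nth false g) (nth false g') v v 0 (or_introl erefl) vn erefl _ _ j jk) => /=; last by rewrite !add0n !qk.
(* A vertex that is idle in the first phase sits beyond the last complete block, hence among the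
   last 2^k positions, where the second phase would act. *)
apply/negPn/negP=> na.
have [_ Ep] := phase_inactive (nth false g) (or_introl (erefl 0)) vn.
move: aq (na); rewrite -(qk g gG) -{1}[k]add0n Ep //=.
by rewrite /active ltnn k0 /=; have := ltn_pmod v sz0; have := leq_mod v (2 ^ k); lia.
Qed.

End Network.

(** * Monochromatic edges *)

Lemma card_dep_pair_le (A B : finType) (P : {set A}) (Q : A -> {set B}) c m :
  #|P| <= c -> (forall a, a \in P -> #|Q a| <= m) ->
  #|[set ab : A * B | (ab.1 \in P) && (ab.2 \in Q ab.1)]| <= c * m.
Proof.
move=> Pc Qm; rewrite -sum1dep_card -(pair_big_dep (mem P) (fun a => mem (Q a)) (fun _ _ => 1)) /=.
apply: (@leq_trans (\sum_(a in P) m)).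
  by apply: leq_sum => a /Qm; rewrite sum1_card.
by rewrite sum_nat_const leq_mul2r Pc orbT.
Qed.

Lemma card_residue_class n m c : 0 < m -> c < m ->
  #|[set i : 'I_n | i %% m == c]| = n %/ m + (c < n %% m).
Proof.
move=> m0 cm; rewrite -sum1dep_card big_mkcond /=.
elim: n => [|n IH]; first by rewrite big_ord0 div0n mod0n.
rewrite big_ord_recr /= IH.
have nm := ltn_pmod n m0; have En := divn_eq n m.
have [lt|ge] := ltnP (n %% m).+1 m.
  have -> : n.+1 %/ m = n %/ m.
    by rewrite {1}En -addnS divnMDl // (divn_small lt) addn0.
  have -> : n.+1 %% m = (n %% m).+1 by rewrite {1}En -addnS modnMDl modn_small.
  by rewrite -addnA; congr (_ + _); rewrite ltnS; case: ltngtP.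
have Em : (n %% m).+1 = m by apply/eqP; rewrite eqn_leq ge nm.
have -> : n.+1 %/ m = (n %/ m).+1 by rewrite {1}En -addnS Em divnMDl // divnn m0 addn1.
have -> : n.+1 %% m = 0 by rewrite {1}En -addnS Em modnMDl modnn.
rewrite ltn0 addn0 -[in RHS]addn1 -[LHS]addnA; congr (_ + _).
by move: cm; rewrite -{1}Em ltnS; case: ltngtP.
Qed.

Section Coloring.
Variables (n r k d : nat) (E : {set {set 'I_n}}).
Hypothesis k0 : 0 < k.
Hypothesis kn : 2 ^ k <= n.
Hypothesis kr : 2 ^ k.+1 <= r.
Hypothesis E3 : forall e, e \in E -> #|e| = 3.
Hypothesis Ed : forall v, #|[set e in E | v \in e]| <= d.

Notation K := (k + k).
Notation M := (K * n).
Notation state := (assignment 'I_M).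
Implicit Types (s t p : state) (e : {set 'I_n}).

Let n0 : 0 < n. Proof. by rewrite (leq_trans _ kn) // expn_gt0. Qed.
Let M0 : 0 < M. Proof. by rewrite muln_gt0 addn_gt0 k0. Qed.

Definition lookup (s : state) (i : nat) : option bool :=
  if insub i is Some x then s x else None.

Lemma lookup_val s (x : 'I_M) : lookup s x = s x.
Proof. by rewrite /lookup valK. Qed.

(** An unassigned bit counts as 0, so walks are defined, and injective in the start, for every
    partial assignment. *)
Fixpoint walk (s : state) (v l : nat) : nat :=
  if l is l'.+1 then
    target n k (lookup s (l' * n + switch n k l' (walk s v l')) == Some true) l' (walk s v l')
  else v.

Definition cell s v l := l * n + switch n k l (walk s v l).
Definition known s v := all (fun l => lookup s (cell s v l) != None) (iota 0 K).
Definition color s v := walk s v K %% r.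
Definition bad s (e : {set 'I_n}) :=
  [forall u in e, known s u] && [forall u in e, forall w in e, color s u == color s w].

Lemma walk_lt s v l : v < n -> walk s v l < n.
Proof. by move=> vn; elim: l => //= l IH; apply: target_lt. Qed.

Lemma walk_chunk s v l : v < n -> chunk n k (walk s v l) = chunk n k v.
Proof. by move=> vn; elim: l => //= l IH; rewrite target_chunk // walk_lt. Qed.

Lemma walk_inj s v w l : v < n -> w < n -> walk s v l = walk s w l -> v = w.
Proof.
move=> vn wn; elim: l => //= l IH Ew; apply: IH.
have [Es] := target_eq k0 kn (walk_lt s l vn) (walk_lt s l wn) Ew.
by apply; rewrite Es.
Qed.

Lemma divn_cell s v l : v < n -> cell s v l %/ n = l.
Proof. by move=> vn; rewrite divnMDl // divn_small ?addn0 // switch_lt // walk_lt. Qed.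

Lemma modn_cell s v l : v < n -> cell s v l %% n = switch n k l (walk s v l).
Proof. by move=> vn; rewrite modnMDl modn_small // switch_lt // walk_lt. Qed.

Lemma cell_lt s v l : v < n -> l < K -> cell s v l < M.
Proof.
move=> vn lK; rewrite -ltn_divLR ?divn_cell //.
Qed.

Lemma knownP s v : reflect (forall l, l < K -> lookup s (cell s v l) != None) (known s v).
Proof.
apply: (iffP allP) => H l; first by move=> lK; apply: H; rewrite mem_iota.
by rewrite mem_iota /= add0n => /H.
Qed.

Lemma badP s e : reflect ((forall u, u \in e -> known s u) /\
  (forall u w, u \in e -> w \in e -> color s u = color s w)) (bad s e).
Proof.
apply: (iffP andP) => [[/forall_inP H1 /forall_inP H2]|[H1 H2]]; split=> //.
- by move=> u w /H2 /forall_inP H /H /eqP.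
- by apply/forall_inP.
by apply/forall_inP=> u ue; apply/forall_inP=> w we; rewrite (H2 u w).
Qed.

(** Walks preserve chunks, equal colors in a chunk are equal positions, and distinct vertices end at
    distinct positions. *)
Lemma bad_chunk s e (u w : 'I_n) : bad s e -> u \in e -> w \in e ->
  chunk n k u = chunk n k w -> u = w.
Proof.
move=> /badP[_ H] ue we Ec; apply/val_inj/(@walk_inj s u w K) => //.
apply: (chunk_mod k0 kn kr); rewrite ?walk_lt ?walk_chunk //.
exact: H.
Qed.

(** A switch joins positions of one chunk only, so the paths of a bad edge are disjoint. This gives
    its pattern exactly 6k cells. *)
Lemma bad_cell_inj s e (u w : 'I_n) l : bad s e -> u \in e -> w \in e ->
  cell s u l = cell s w l -> u = w.
Proof.
move=> be ue we /addnI Es; apply: (bad_chunk be) => //.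
by rewrite -(walk_chunk s l (ltn_ord u)) -(walk_chunk s l (ltn_ord w))
  -(switch_chunk k0 kn l) ?walk_lt // Es switch_chunk ?walk_lt.
Qed.

Lemma eq_walk s t v l : (forall j, j < l -> lookup t (cell s v j) = lookup s (cell s v j)) ->
  walk t v l = walk s v l.
Proof.
elim: l => //= l IH H; rewrite IH; last by move=> j jl; apply: H; apply: ltnW.
by rewrite (H l).
Qed.

Lemma lookup_sub p s i : subassignment p s -> lookup p i != None -> lookup s i = lookup p i.
Proof.
rewrite /lookup; case: insubP => // x _ _ /subassignmentP H px.
by rewrite H.
Qed.

Definition restrict s (e : {set 'I_n}) : state :=
  [ffun x : 'I_M => if [exists v in e, nat_of_ord x == cell s v (x %/ n)] then s x else None].

Lemma restrict_sub s e : subassignment (restrict s e) s.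
Proof. by apply/subassignmentP=> x; rewrite ffunE; case: ifP. Qed.

Lemma lookup_restrict s (e : {set 'I_n}) (v : 'I_n) l : v \in e -> lookup (restrict s e) (cell s v l) = lookup s (cell s v l).
Proof.
move=> ve; rewrite /lookup; case: insubP => // x _ /= Ex; rewrite ffunE.
case: ifP => // /negbT/exists_inPn/(_ v ve).
by rewrite Ex divn_cell // eqxx.
Qed.

(** A walk depends only on the bits along it, so agreement on these cells reproduces the paths,
    their completeness and the colors. *)
Lemma bad_sub s t e : bad s e -> subassignment (restrict s e) t -> bad t e.
Proof.
move=> be st; case/badP: (be) => H1 H2.
have L u l : u \in e -> l < K -> lookup t (cell s u l) = lookup s (cell s u l).
  move=> ue lK; rewrite -(lookup_restrict s l ue) (lookup_sub st) //.
  by rewrite lookup_restrict //; apply: (knownP _ _ (H1 u ue)).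
have W u l : u \in e -> l <= K -> walk t u l = walk s u l.
  by move=> ue lK; apply: eq_walk => j jl; apply: L => //; apply: leq_trans lK.
apply/badP; split=> [u ue|u w ue we]; last by rewrite /color !W //; apply: H2.
apply/knownP=> l lK; rewrite /cell W ?(ltnW lK) //.
by have := L u l ue lK; rewrite /cell => ->; apply: (knownP _ _ (H1 u ue)).
Qed.

Definition bad_patterns : {set state} :=
  [set p | [exists e in E, [exists s, bad s e && (p == restrict s e)]]].

Lemma bad_patternsP p :
  reflect (exists e s, [/\ e \in E, bad s e & p = restrict s e]) (p \in bad_patterns).
Proof.
rewrite inE; apply: (iffP exists_inP) => [[e eE /existsP[s /andP[be /eqP Ep]]]|[e [s [eE be Ep]]]].
  by exists e, s.
by exists e => //; apply/existsP; exists s; rewrite be Ep eqxx.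
Qed.

Lemma support_restrict s e : bad s e ->
  support (restrict s e) = [set Ordinal (cell_lt s (ltn_ord ul.1) (ltn_ord ul.2)) | ul in setX e [set: 'I_K]].
Proof.
move=> /badP[kn_ _]; apply/setP=> x; rewrite inE ffunE; apply/idP/imsetP.
  case: ifP => // /exists_inP[v ve /eqP Ex] _.
  have lK : x %/ n < K by rewrite ltn_divLR.
  exists (v, Ordinal lK); first by rewrite !inE ve.
  exact/val_inj.
move=> [[v l] /setXP[/= ve _] ->] /=; case: ifP => [_|].
  rewrite -lookup_val /=; exact: (knownP _ _ (kn_ v ve)).
by move/negbT/exists_inPn/(_ v ve); rewrite divn_cell // eqxx.
Qed.

Lemma bad_pattern_size p : p \in bad_patterns -> #|support p| = 3 * K.
Proof.
case/bad_patternsP=> e [s [eE be ->]]; rewrite support_restrict //.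
rewrite card_in_imset ?cardsX ?cardsT ?card_ord ?E3 //.
move=> [u l] [w j] /setXP[/= ue _] /setXP[/= we _] [Ec].
have El : nat_of_ord l = j.
  by have := divn_cell s l (ltn_ord u); rewrite Ec divn_cell.
have Ew : u = w by rewrite El in Ec; apply: (bad_cell_inj be ue we Ec).
by rewrite Ew; congr pair; apply: val_inj.
Qed.

(** The last bad edge of the enumeration, as it is found by a program that overwrites its record at
    each hit. *)
Definition found s : option {set 'I_n} :=
  foldl (fun o e => if bad s e then Some e else o) None (enum E).

Lemma foundP s : if found s is Some e then e \in E /\ bad s e
  else forall e, e \in E -> ~~ bad s e.
Proof.
rewrite /found -[enum E]revK foldl_rev.
have mE e : (e \in rev (enum E)) = (e \in E) by rewrite mem_rev mem_enum.
suff : forall es : seq {set 'I_n}, if foldr (fun e o => if bad s e then Some e else o) None es is Some e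
    then e \in es /\ bad s e else forall e, e \in es -> ~~ bad s e.
  move=> /(_ (rev (enum E))); case: foldr => [e|]; first by rewrite mE.
  by move=> H e; rewrite -mE => /H.
elim=> //= e es IH; case: ifP => [be|/negbT nbe]; first by rewrite mem_head.
case: foldr IH => [e' [e'es be']|IH e']; first by rewrite inE e'es orbT.
by rewrite inE => /predU1P[->|/IH].
Qed.

Definition bad_choice s : option state := omap (restrict s) (found s).

Lemma bad_choice_some s p : bad_choice s = Some p ->
  p \in bad_patterns /\ subassignment p s.
Proof.
rewrite /bad_choice; have := foundP s; case: found => //= e [eE be] [<-].
by split; [apply/bad_patternsP; exists e, s | apply: restrict_sub].
Qed.

Lemma bad_choice_none s : bad_choice s = None ->
  forall p, p \in bad_patterns -> ~~ subassignment p s.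
Proof.
rewrite /bad_choice; have := foundP s; case: found => //= H _ p.
case/bad_patternsP=> e [t [eE be ->]]; apply/negP=> /(bad_sub be).
exact/negP/H.
Qed.

Definition last_unassigned (A : {set 'I_M}) : 'I_M :=
  last (Ordinal M0) [seq x <- enum 'I_M | x \notin A].

Lemma last_unassignedP A : A != [set: 'I_M] -> last_unassigned A \notin A.
Proof.
rewrite -subTset => /subsetPn[x _ xA]; rewrite /last_unassigned.
have : x \in [seq x <- enum 'I_M | x \notin A] by rewrite mem_filter xA mem_enum.
case Es : [seq _ <- _ | _] => [|z zs] // _.
have : last z zs \in [seq x <- enum 'I_M | x \notin A] by rewrite Es mem_last.
by rewrite mem_filter => /andP[].
Qed.

Lemma empty_pattern_free : pattern_free bad_patterns (empty_assignment 'I_M).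
Proof.
apply/pattern_freeP=> p pP; apply/negP=> /support_subassignment/subset_leq_card.
rewrite (bad_pattern_size pP) (_ : support _ = set0) ?cards0.
  by rewrite leqn0 muln_eq0 addn_eq0 /= andbb eqn0Ngt k0.
by apply/setP=> x; rewrite !inE ffunE.
Qed.

Definition bits s v : K.-tuple bool :=
  [tuple lookup s (cell s v l) == Some true | l < K].

Lemma nth_bits s v l : l < K -> nth false (bits s v) l = (lookup s (cell s v l) == Some true).
Proof. by move=> lK; rewrite -[l in LHS]/(val (Ordinal lK)) -tnth_nth tnth_mktuple. Qed.

Lemma walk_position s v l : l <= K -> walk s v l = position n k (nth false (bits s v)) v l.
Proof.
elim: l => //= l IH lK; rewrite -IH ?(ltnW lK) //.
by rewrite nth_bits.
Qed.

(** The partial assignment used by a walk from [v] that takes the bits [g] in order, without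
    reference to a stored assignment. *)
Definition trace (v : 'I_n) (g : K.-tuple bool) (x : 'I_M) : option bool :=
  if x %% n == switch n k (x %/ n) (position n k (nth false g) v (x %/ n))
  then Some (nth false g (x %/ n)) else None.

(** Decodes a pattern from the vertices of an edge and their bit strings. The order of the cases is
    immaterial when the strings stem from one assignment. *)
Definition traces (z : (K.-tuple bool * 'I_n) * (('I_n * 'I_n) * (K.-tuple bool * K.-tuple bool))) : state :=
  [ffun x => let: ((g, v), ((a, b), (h, i))) := z in
    if trace v g x is Some c then Some c else
    if trace a h x is Some c then Some c else trace b i x].

Lemma trace_bits s (v : 'I_n) (x : 'I_M) : known s v ->
  trace v (bits s v) x = if nat_of_ord x == cell s v (x %/ n) then s x else None.
Proof.
move=> /knownP kv; have lK : x %/ n < K by rewrite ltn_divLR.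
rewrite /trace -walk_position ?(ltnW lK) //.
have -> : (x %% n == switch n k (x %/ n) (walk s v (x %/ n))) = (nat_of_ord x == cell s v (x %/ n)).
  apply/eqP/eqP => Ex; first by rewrite /cell -Ex -divn_eq.
  by rewrite -(modn_cell s (x %/ n) (ltn_ord v)) -Ex.
case: eqP => // Ex; rewrite nth_bits //.
by have := kv _ lK; rewrite -Ex lookup_val; case: (s x) => [[]|].
Qed.

Definition through (l q : nat) : {set K.-tuple bool * 'I_n} :=
  [set gv : K.-tuple bool * 'I_n | switch n k l (position n k (nth false gv.1) gv.2 l) == q].

(** For fixed bits the first [l] layers are injective, and a switch serves two positions, so at most
    two start vertices lead to it. *)
Lemma card_through l q : #|through l q| <= 2 ^ K * 2.
Proof.
have : #|[set gv : K.-tuple bool * 'I_n | (gv.1 \in [set: K.-tuple bool]) &&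
    (gv.2 \in [set v : 'I_n | switch n k l (position n k (nth false gv.1) v l) == q])]| <= 2 ^ K * 2.
  apply: (card_dep_pair_le (Q := fun g : K.-tuple bool => [set v : 'I_n | switch n k l (position n k (nth false g) v l) == q])).
    by rewrite cardsT card_tuple card_bool.
  move=> g _; set S := [set v | _].
  pose f (v : 'I_n) := position n k (nth false g) v l == q.
  have finj : {in S &, injective f}.
    move=> u w; rewrite !inE => /eqP Eu /eqP Ew Ef; apply/val_inj.
    apply: (position_inj k0 kn (ltn_ord u) (ltn_ord w) (g := nth false g) (l := l)).
    have Pu := position_lt k0 kn (nth false g) l (ltn_ord u).
    have Pw := position_lt k0 kn (nth false g) l (ltn_ord w).
    have := switch_fiber k0 kn l Pu; have := switch_fiber k0 kn l Pw.
    have hq : (q + half k == q) = false.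
      by rewrite -[X in _ == X]addn0 eqn_add2l /half expn_eq0.
    by move: Ef; rewrite /f Eu Ew => Ef [] Dw [] Du; move: Ef; rewrite Dw Du ?eqxx ?hq.
  by rewrite -(card_in_imset finj) (leq_trans (max_card _)) // card_bool.
by apply: leq_trans; apply/subset_leq_card/subsetP=> -[g v]; rewrite !inE.
Qed.

Definition neighbors (v : 'I_n) : {set 'I_n * 'I_n} :=
  [set ab | [exists e in E, [&& v \in e, ab.1 \in e :\ v & ab.2 \in e :\ v]]].

(** The pairs are ordered and may repeat a vertex: 2 * 2 of them for each of at most [d] edges. *)
Lemma card_neighbors v : #|neighbors v| <= d * 4.
Proof.
have H : #|[set eab : {set 'I_n} * ('I_n * 'I_n) | (eab.1 \in [set e in E | v \in e]) &&
    (eab.2 \in setX (eab.1 :\ v) (eab.1 :\ v))]| <= d * 4.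
  apply: (card_dep_pair_le (Q := fun e => setX (e :\ v) (e :\ v))) => // e.
  rewrite inE => /andP[/E3 e3 ve]; rewrite cardsX.
  by have := cardsD1 v e; rewrite ve e3 add1n => -[<-].
apply: leq_trans H.
apply: leq_trans (leq_imset_card (@snd _ _) _).
apply/subset_leq_card/subsetP=> -[a b]; rewrite inE => /exists_inP[e eE /and3P[ve ae be]].
by apply/imsetP; exists (e, (a, b)) => //; rewrite !inE /= in ae be *; rewrite eE ve ae be.
Qed.

Definition landing (v : 'I_n) (c : nat) : {set K.-tuple bool} :=
  [set g : K.-tuple bool | position n k (nth false g) v K %% r == c].

(** Since chunks are preserved, all strings that give [v] the color [c] lead to one and the same
    position. *)
Lemma card_landing v c : #|landing v c| <= 2 ^ k.
Proof.
have [->|[g gc]] := set_0Vmem (landing v c); first by rewrite cards0.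
apply: leq_trans (position_bits k0 kn (position n k (nth false g) v K) (ltn_ord v)).
apply/subset_leq_card/subsetP=> h; rewrite inE => hc; rewrite inE; apply/eqP.
apply: (chunk_mod k0 kn kr); rewrite ?position_lt ?position_chunk //.
by move: gc; rewrite inE => /eqP ->; apply/eqP.
Qed.

Definition meeting_bits c (ab : 'I_n * 'I_n) := setX (landing ab.1 c) (landing ab.2 c).

Definition completions (gv : K.-tuple bool * 'I_n) :=
  [set y : ('I_n * 'I_n) * (K.-tuple bool * K.-tuple bool) |
    (y.1 \in neighbors gv.2) &&
    (y.2 \in meeting_bits (position n k (nth false gv.1) gv.2 K %% r) y.1)].

Definition pattern_codes (l q : nat) :=
  [set z : (K.-tuple bool * 'I_n) * (('I_n * 'I_n) * (K.-tuple bool * K.-tuple bool)) |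
    (z.1 \in through l q) && (z.2 \in completions z.1)].

Lemma card_pattern_codes l q : #|pattern_codes l q| <= 8 * d * 16 ^ k.
Proof.
have -> : 8 * d * 16 ^ k = 2 ^ K * 2 * (d * 4 * (2 ^ k * 2 ^ k)).
  have -> : 16 ^ k = 2 ^ k * 2 ^ k * (2 ^ k * 2 ^ k) by rewrite -!expnMn.
  by rewrite expnD; ring.
apply: (card_dep_pair_le (Q := completions)) (card_through l q) _ => -[g v] _.
set c := position n k (nth false g) v K %% r.
apply: (card_dep_pair_le (Q := meeting_bits c)) (card_neighbors v) _ => -[a b] _.
by rewrite cardsX leq_mul // card_landing.
Qed.

(** One vertex of the edge passes through the switch of [x]; its color is then prescribed to the
    other two, which leaves each of them at most 2^k bit strings. *)
Lemma patterns_through_cell (x : 'I_M) :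
  #|[set p in bad_patterns | p x != None]| <= 8 * d * 16 ^ k.
Proof.
apply: leq_trans (card_pattern_codes (x %/ n) (x %% n)).
apply: leq_trans (leq_imset_card traces _).
apply/subset_leq_card/subsetP=> p; rewrite inE => /andP[/bad_patternsP[e [s [eE be Ep]]]].
rewrite Ep ffunE; case: ifP => // /exists_inP[v ve /eqP Ex] _.
have [kn_ Ec] := badP _ _ be.
have e2 : #|e :\ v| == 2 by have := cardsD1 v e; rewrite ve (E3 eE) add1n => -[<-].
have /cards2P[a [b [ab Eab]]] := e2.
have aev : a \in e :\ v by rewrite Eab !inE eqxx.
have bev : b \in e :\ v by rewrite Eab !inE eqxx orbT.
have ae : a \in e by move: aev; rewrite !inE => /andP[].
have bee : b \in e by move: bev; rewrite !inE => /andP[].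
have posK u : position n k (nth false (bits s u)) u K = walk s u K by rewrite -walk_position.
apply/imsetP; exists ((bits s v, v), ((a, b), (bits s a, bits s b))).
  rewrite !inE /= !posK; apply/and4P; split.
  - rewrite -walk_position; last by rewrite ltnW // ltn_divLR.
    by rewrite -(modn_cell s (x %/ n) (ltn_ord v)) -Ex.
  - by apply/exists_inP; exists e => //; rewrite ve aev.
  - by apply/eqP; apply: Ec.
  by apply/eqP; apply: Ec.
apply/ffunP=> z; rewrite !ffunE !trace_bits ?kn_ //.
have kz u : u \in e -> nat_of_ord z = cell s u (z %/ n) -> s z != None.
  move=> ue Ez; rewrite -lookup_val Ez; apply: (knownP _ _ (kn_ u ue)).
  by rewrite ltn_divLR.
case: ifP => [/exists_inP[u ue /eqP Ez]|/negbT/exists_inPn H].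
  have := kz _ ue Ez; case Sz: (s z) => [c|] // _.
  have : (u == v) || (u \in e :\ v) by rewrite !inE ue andbT orbN.
  have Ez' : nat_of_ord z == cell s u (z %/ n) by apply/eqP.
  by rewrite Eab !inE => /or3P[] /eqP Eu; rewrite -Eu Ez'; do 2?case: ifP.
by rewrite !(negbTE (H _ _)).
Qed.

Lemma pattern_free_not_bad s : pattern_free bad_patterns s ->
  forall e, e \in E -> ~~ bad s e.
Proof.
move=> /pattern_freeP H e eE; apply/negP=> be.
have /H/negP : restrict s e \in bad_patterns by apply/bad_patternsP; exists e, s.
by apply; apply: restrict_sub.
Qed.

Lemma complete_coloring s : (forall e, e \in E -> ~~ bad s e) -> complete_assignment s ->
  exists f : 'I_n -> 'I_r, (forall v, val (f v) = color s v) /\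
    (forall e, e \in E -> ~ exists c, forall v, v \in e -> f v = c) /\
    (forall c, #|[set v | f v == c]| = n %/ r + (c < n %% r)).
Proof.
move=> nb cs.
have r0 : 0 < r by rewrite (leq_trans _ kr) // expn_gt0.
have cr v : color s v < r by rewrite ltn_pmod.
exists (fun v => Ordinal (cr v)); split=> //; split.
  move=> e eE [c Hc]; have /negP := nb e eE; apply; apply/badP; split.
    move=> u ue; apply/knownP=> l lK.
    have := cell_lt s (ltn_ord u) lK; move=> H; rewrite (_ : cell s u l = Ordinal H) // lookup_val.
    by move/eqP: cs => /setP/(_ (Ordinal H)); rewrite !inE.
  by move=> u w ue we; have := Hc u ue; have := Hc w we; rewrite -[c]/c => <- [].
move=> c; rewrite -(card_residue_class n r0 (ltn_ord c)).
(* Final positions form a permutation, so each color class corresponds to a residue class modulo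
   [r]. *)
have winj : injective (fun v : 'I_n => Ordinal (walk_lt s K (ltn_ord v))).
  by move=> u w [] /(walk_inj (ltn_ord u) (ltn_ord w)) H; apply: val_inj.
rewrite -(card_imset _ winj); apply: eq_card => p; rewrite !inE.
apply/imsetP/idP => [[v]|pc].
  by rewrite inE => /eqP <- ->.
have /codomP[v Ep] := injF_onto winj p.
exists v => //; rewrite inE; apply/eqP/val_inj => /=.
by apply/eqP; rewrite -[X in _ == X](eqP pc) Ep.
Qed.

End Coloring.

(** * Structured programs *)

(* [PFor i b p] runs p with the cell i[0] equal to 0, 1, ..., below the value of
   the cell b[0], which p must not modify. *)
Inductive prog : Type :=
  | PSkip
  | PPut of nat & expr & expr
  | PSeq of prog & prog
  | PIf of expr & prog & prog
  | PFor of nat & nat & prog.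

Fixpoint compile (p : prog) : cmd :=
  match p with
  | PSkip => Skip
  | PPut a i e => Put a i e
  | PSeq p q => Seq (compile p) (compile q)
  | PIf e p q => If e (compile p) (compile q)
  | PFor i b p =>
      Seq (Put i (Const 0) (Const 0))
        (While (Defs.Sub (Get b (Const 0)) (Get i (Const 0)))
           (Seq (compile p) (Put i (Const 0) (Add (Get i (Const 0)) (Const 1)))))
  end.

(** The number of rounds is read once on entry, whereas the machine tests the bound in every round;
    both agree when the body leaves bound and counter alone. *)
Fixpoint den (p : prog) (m : memory) : memory :=
  match p with
  | PSkip => m
  | PPut a i e => update m a (eval m i) (eval m e)
  | PSeq p q => den q (den p m)
  | PIf e p q => if eval m e != 0 then den p m else den q m
  | PFor i b p => iteri (m b 0) (fun j m => update (den p m) i 0 j.+1) (update m i 0 0)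
  end.

Fixpoint written (p : prog) : seq nat :=
  match p with
  | PSkip => [::]
  | PPut a _ _ => [:: a]
  | PSeq p q | PIf _ p q => written p ++ written q
  | PFor i _ p => i :: written p
  end.

Fixpoint bounds (p : prog) : seq nat :=
  match p with
  | PSkip | PPut _ _ _ => [::]
  | PSeq p q | PIf _ p q => bounds p ++ bounds q
  | PFor _ b p => b :: bounds p
  end.

Fixpoint counters_safe (p : prog) : bool :=
  match p with
  | PSkip | PPut _ _ _ => true
  | PSeq p q | PIf _ p q => counters_safe p && counters_safe q
  | PFor i _ p => (i \notin written p) && counters_safe p
  end.

(** No bound is written anywhere in the program, not even before its loop, so the running time is
    controlled by the initial memory. *)
Definition well_formed (p : prog) : bool :=
  counters_safe p && all (fun b => b \notin written p) (bounds p).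

Fixpoint time_bound (p : prog) (env : nat -> nat) : nat :=
  match p with
  | PSkip | PPut _ _ _ => 1
  | PSeq p q | PIf _ p q => (time_bound p env + time_bound q env).+1
  | PFor _ b p => env b * (time_bound p env + 3) + 3
  end.

Lemma iteri_inv (T : Type) (P : nat -> T -> Prop) (f : nat -> T -> T) N x :
  P 0 x -> (forall j y, j < N -> P j y -> P j.+1 (f j y)) -> P N (iteri N f x).
Proof.
move=> P0; elim: N => //= N IH PS; apply: (PS) => //.
by apply: IH => j y jN; apply: PS; apply: ltnW.
Qed.

Lemma den_frame p m a i : a \notin written p -> den p m a i = m a i.
Proof.
elim: p m => //= [b j e|p IHp q IHq|e p IHp q IHq|j b p IHp] m.
- by rewrite inE /update => /negbTE ->.
- by rewrite mem_cat negb_or => /andP[/IHp Hp /IHq Hq]; rewrite Hq Hp.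
- by rewrite mem_cat negb_or => /andP[/IHp Hp /IHq Hq]; case: ifP.
rewrite inE negb_or => /andP[/negbTE ai /IHp Hp].
apply: (@iteri_inv _ (fun _ m' => m' a i = m a i)); first by rewrite /update ai.
by move=> l y _ <-; rewrite {1}/update ai /= Hp.
Qed.

Lemma run_cat s c1 c2 : run s (c1 ++ c2) = run (run s c1) c2.
Proof. exact: foldl_cat. Qed.

(** The number of steps is exact and the same for all coins; this describes the deterministic
    stretches between flips. *)
Definition reaches (s : config) (t : nat) (s' : config) :=
  forall coins, size coins = t -> run s coins = s'.

Lemma reaches0 s : reaches s 0 s.
Proof. by move=> coins /size0nil ->. Qed.

Lemma reaches_step s s' : (forall b, step s b = s') -> reaches s 1 s'.
Proof. by move=> H [|b []] //= _; rewrite /run /= H. Qed.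

Lemma reaches_trans s1 s2 s3 t1 t2 :
  reaches s1 t1 s2 -> reaches s2 t2 s3 -> reaches s1 (t1 + t2) s3.
Proof.
move=> H1 H2 coins sc; rewrite -(cat_take_drop t1 coins) run_cat.
have st : size (take t1 coins) = t1 by rewrite size_takel // sc leq_addr.
rewrite (H1 _ st) (H2 (drop t1 coins)) //.
by rewrite size_drop sc addKn.
Qed.

Lemma reaches_compile p env ks m : counters_safe p ->
  (forall b, b \in bounds p -> b \notin written p) ->
  (forall b, b \in bounds p -> m b 0 = env b) ->
  exists2 t, t <= time_bound p env & reaches (compile p :: ks, m) t (ks, den p m).
Proof.
elim: p ks m => /= [|a i e|p IHp q IHq|e p IHp q IHq|i b p IHp] ks m.
- by exists 1 => //; apply: reaches_step.
- by exists 1 => //; apply: reaches_step.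
- move=> /andP[sp sq] W B.
  have [|b bp|b bp|t1 Ht1 R1] := IHp (compile q :: ks) m.
  + by [].
  + by have := W b; rewrite mem_cat bp => /(_ isT); rewrite mem_cat negb_or => /andP[].
  + by apply: B; rewrite mem_cat bp.
  have [|b bq|b bq|t2 Ht2 R2] := IHq ks (den p m).
  + by [].
  + by have := W b; rewrite mem_cat bq orbT => /(_ isT); rewrite mem_cat negb_or => /andP[].
  + have := W b; rewrite mem_cat bq orbT => /(_ isT); rewrite mem_cat negb_or => /andP[wp _].
    by rewrite den_frame //; apply: B; rewrite mem_cat bq orbT.
  exists (1 + (t1 + t2)); first by lia.
  apply: reaches_trans (reaches_trans R1 R2).
  exact: reaches_step.
- move=> /andP[sp sq] W B.
  have S1 : reaches (If e (compile p) (compile q) :: ks, m) 1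
     ((if eval m e != 0 then compile p else compile q) :: ks, m) by apply: reaches_step.
  case: ifP S1 => Ee S1.
    have [|b bp|b bp|t1 Ht1 R1] := IHp ks m.
    + by [].
    + by have := W b; rewrite mem_cat bp => /(_ isT); rewrite mem_cat negb_or => /andP[].
    + by apply: B; rewrite mem_cat bp.
    by exists (1 + t1); [lia | apply: reaches_trans R1].
  have [|b bq|b bq|t1 Ht1 R1] := IHq ks m.
  + by [].
  + by have := W b; rewrite mem_cat bq orbT => /(_ isT); rewrite mem_cat negb_or => /andP[].
  + by apply: B; rewrite mem_cat bq orbT.
  by exists (1 + t1); [lia | apply: reaches_trans R1].
move=> /andP[wi sp] W B.
have := W b (mem_head _ _); rewrite inE => /norP[bi wb].
set c := While _ _.
pose F := fun (j : nat) m => update (den p m) i 0 j.+1.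
(* The 3 additional steps of a round are the test, the unfolding of [Seq] and the increment. *)
have loop N : N <= m b 0 -> exists2 t, t <= N * (time_bound p env + 3) &
  reaches (c :: ks, update m i 0 0) t (c :: ks, iteri N F (update m i 0 0)).
  elim: N => [|N IH] HN; first by exists 0 => //; apply: reaches0.
  have [t1 Ht1 R1] := IH (ltnW HN).
  set mN := iteri N F _ in R1.
  have inv b' : b' \in b :: bounds p -> mN b' 0 = env b' /\ b' \notin written p.
    move=> b'in; have := W _ b'in; rewrite inE => /norP[b'i wb']; split=> //.
    rewrite /mN -B //; apply: (@iteri_inv _ (fun _ m' => m' b' 0 = m b' 0)).
      by rewrite /update (negbTE b'i).
    by move=> j y _ <-; rewrite {1}/F {1}/update (negbTE b'i) /= den_frame.
  have iN : mN i 0 = N.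
    rewrite /mN; case: (N) => [|N'] /=; first by rewrite /update !eqxx.
    by rewrite /F /update !eqxx.
  have [|b' b'in|b' b'in|t2 Ht2 R2] := IHp (Put i (Const 0) (Add (Get i (Const 0)) (Const 1)) :: c :: ks) mN.
  - by [].
  - by have [] := inv b'; rewrite ?inE ?b'in ?orbT.
  - by have [] := inv b'; rewrite ?inE ?b'in ?orbT.
  exists (t1 + (1 + (1 + (t2 + 1)))); first by lia.
  apply: reaches_trans R1 _.
  apply: (@reaches_trans _ (Seq (compile p) (Put i (Const 0) (Add (Get i (Const 0)) (Const 1))) :: c :: ks, mN)).
    apply: reaches_step => _ /=.
    have [Eb _] := inv b (mem_head _ _); rewrite iN Eb -B ?mem_head //.
    by rewrite subn_eq0 -ltnNge HN.
  apply: (@reaches_trans _ (compile p :: Put i (Const 0) (Add (Get i (Const 0)) (Const 1)) :: c :: ks, mN)).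
    exact: reaches_step.
  apply: reaches_trans R2 _; apply: reaches_step => _ /=.
  by rewrite /F den_frame // iN addn1.
have [t Ht R] := loop (m b 0) (leqnn _).
exists (1 + (1 + (t + 1))).
  by move: Ht; rewrite (B b (mem_head _ _)); lia.
apply: (@reaches_trans _ (Put i (Const 0) (Const 0) :: c :: ks, m)); first exact: reaches_step.
apply: (@reaches_trans _ (c :: ks, update m i 0 0)); first exact: reaches_step.
apply: reaches_trans R _; apply: reaches_step => _ /=.
have -> : iteri (m b 0) F (update m i 0 0) i 0 = m b 0.
  by case: (m b 0) => [|N'] /=; rewrite ?/F /update !eqxx.
have -> : iteri (m b 0) F (update m i 0 0) b 0 = m b 0.
  apply: (@iteri_inv _ (fun _ m' => m' b 0 = m b 0)); first by rewrite /update (negbTE bi).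
  by move=> j y _ <-; rewrite {1}/F {1}/update (negbTE bi) /= den_frame.
by rewrite subnn.
Qed.

Lemma reaches_prog p ks m : well_formed p ->
  exists2 t, t <= time_bound p (fun b => m b 0) &
    reaches (compile p :: ks, m) t (ks, den p m).
Proof.
move=> /andP[sp /allP W]; exact: reaches_compile.
Qed.

Lemma run_halted s coins : halted s -> run s coins = s.
Proof.
by rewrite /halted; case: s => [[|c ks] m] //= _; elim: coins.
Qed.

(** Partial correctness under at most [N] coins; the bound permits induction over a loop that need
    not terminate. *)
Definition safe (Q : config -> Prop) (N : nat) (s : config) :=
  forall coins, size coins <= N -> halted (run s coins) -> Q (run s coins).

Lemma safe_reaches Q N s t s' : reaches s t s' -> safe Q N s' -> safe Q N s.
Proof.
move=> R S coins sc hc.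
(* The execution may halt within fewer than [t] coins; padding makes the sequence long enough and
   leaves a halted configuration unchanged. *)
pose X := coins ++ nseq t false.
have E : run s coins = run s X by rewrite /X run_cat [RHS]run_halted.
have E2 : run s coins = run s' (drop t X).
  rewrite E -[in LHS](cat_take_drop t X) run_cat R //.
  by rewrite size_takel // size_cat size_nseq leq_addl.
rewrite E2; apply: S; last by rewrite -E2.
by rewrite size_drop size_cat size_nseq addnK.
Qed.

Lemma safe_halted (Q : config -> Prop) N s : halted s -> Q s -> safe Q N s.
Proof. by move=> hs Qs coins _ _; rewrite run_halted. Qed.

Lemma safe_running Q N s : ~~ halted s ->
  (forall N' b, N = N'.+1 -> safe Q N' (step s b)) -> safe Q N s.
Proof.
move=> nh H [|b coins] sc; first by rewrite /run /= (negbTE nh).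
by case: N H sc => // N H sc; apply: (H N b).
Qed.

(** * The search program *)

(* Arrays: 0 input; 1 colors; 2 = 2^k, 3 = 2^(k-1), 4 = k, 5 = 2k, 6 = 2kn, 26 = number of
   edges; 7 switches and 8, 9 targets for the bits 0, 1, at p for the first k layers
   and at n + p for the others; 10 residues mod r; 11 the assignment, with 0 for
   unassigned and b + 1 for b; 12 the last coin; 13 successor of the last unassigned
   variable, or 0; 14 address of the last bad edge, or 0; 15-19 local to [walk_prog];
   20 nonzero if the path of v has an unassigned variable; 21-23 counters. *)
Local Notation getc a := (Get a (Const 0)).
Local Notation "x :+ y" := (Add x y) (at level 50, left associativity).
Local Notation "x :- y" := (Defs.Sub x y) (at level 50, left associativity).
Local Notation "p ;; q" := (PSeq p q) (at level 60, right associativity).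
Local Notation setc a e := (PPut a (Const 0) e).

(** Arrays 15 to 19 hold the position, the flag for an unassigned bit, the layer times n, the start
    of the table for the phase, and the address of the bit. The truncated difference of a code and 1
    is nonzero only for a true bit, so an unassigned bit is read as false. The bit is erased after
    it has been used. *)
Definition walk_body (er : bool) : prog :=
  PIf (getc 4 :- getc 22) (setc 18 (Const 0)) (setc 18 (getc 0)) ;;
  setc 19 (getc 17 :+ Get 7 (getc 18 :+ getc 15)) ;;
  PIf (Get 11 (getc 19)) PSkip (setc 16 (Const 1)) ;;
  PIf (Get 11 (getc 19) :- Const 1) (setc 15 (Get 9 (getc 18 :+ getc 15))) (setc 15 (Get 8 (getc 18 :+ getc 15))) ;;
  (if er then PPut 11 (getc 19) (Const 0) else PSkip) ;;
  setc 17 (getc 17 :+ getc 0).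

Definition walk_prog (er : bool) (v : expr) : prog :=
  setc 15 v ;; setc 16 (Const 0) ;; setc 17 (Const 0) ;; PFor 22 5 (walk_body er).

Definition color_prog : prog :=
  PFor 21 0 (walk_prog false (getc 21) ;;
    PPut 1 (getc 21) (Get 10 (getc 15)) ;; PPut 20 (getc 21) (getc 16)).

(** A sum of naturals vanishes only if all summands do; equality of colors takes the truncated
    differences in both directions. *)
Definition bad_expr : expr :=
  let u := Get 0 (getc 23) in
  let v := Get 0 (getc 23 :+ Const 1) in
  let w := Get 0 (getc 23 :+ Const 2) in
  Get 20 u :+ Get 20 v :+ Get 20 w :+ (Get 1 u :- Get 1 v) :+ (Get 1 v :- Get 1 u)
  :+ (Get 1 u :- Get 1 w) :+ (Get 1 w :- Get 1 u).

(** The edge list starts at address 3, so 0 is free to mean that no edge is bad. *)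
Definition find_prog : prog :=
  setc 14 (Const 0) ;; setc 23 (Const 3) ;;
  PFor 21 26 (PIf bad_expr PSkip (setc 14 (getc 23)) ;; setc 23 (getc 23 :+ Const 3)).

Definition erase_prog : prog :=
  PIf (getc 14)
    (walk_prog true (Get 0 (getc 14)) ;;
     walk_prog true (Get 0 (getc 14 :+ Const 1)) ;;
     walk_prog true (Get 0 (getc 14 :+ Const 2)))
    PSkip.

Definition select_prog : prog :=
  setc 13 (Const 0) ;;
  PFor 21 6 (PIf (Get 11 (getc 21)) PSkip (setc 13 (getc 21 :+ Const 1))).

Definition search_prog : prog :=
  PPut 11 (getc 13 :- Const 1) (getc 12 :+ Const 1) ;;
  color_prog ;; find_prog ;; erase_prog ;; select_prog.

Definition agree (ws : seq nat) (m m' : memory) :=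
  forall a, a \notin ws -> forall i, m' a i = m a i.

Lemma agree_trans ws m1 m2 m3 : agree ws m1 m2 -> agree ws m2 m3 -> agree ws m1 m3.
Proof. by move=> H1 H2 a aw i; rewrite H2 // H1. Qed.

Lemma agree_sub ws ws' m m' : {subset ws <= ws'} -> agree ws m m' -> agree ws' m m'.
Proof. by move=> S H a aw; apply: H; apply: contra aw; apply: S. Qed.

Lemma agree_den (p : prog) ws m : all (mem ws) (written p) -> agree ws m (den p m).
Proof. by move=> /allP H a aw i; rewrite den_frame //; apply: contra aw; apply: H. Qed.

Lemma agree_update ws m a i x : a \in ws -> agree ws m (update m a i x).
Proof. by move=> aw b bw j; rewrite /update; case: eqP bw => // ->; rewrite aw. Qed.

(** * The search program carries out one step of the abstract search *)

Section Spec.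
Variables (n r k : nat) (E : {set {set 'I_n}}).
Hypothesis k0 : 0 < k.
Hypothesis kn : 2 ^ k <= n.
Hypothesis kr : 2 ^ k.+1 <= r.
Hypothesis E3 : forall e, e \in E -> #|e| = 3.

Notation K := (k + k).
Notation M := (K * n).
Notation state := (assignment 'I_M).
Implicit Types (s t : state) (m : memory).

Let n0 : 0 < n. Proof. by rewrite (leq_trans _ kn) // expn_gt0. Qed.

Definition code (o : option bool) : nat := if o is Some b then b.+1 else 0.

(** What the precomputation provides and the search leaves intact. All layers of a phase have the
    same switches, so two tables suffice, selected by [o]. *)
Record static m : Prop := Static {
  static_n : m 0 0 = n;
  static_k : m 4 0 = k;
  static_K : m 5 0 = K;
  static_M : m 6 0 = M;
  static_E : m 26 0 = #|E|;
  static_table : forall l p, p < n -> let o := if l < k then 0 else n in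
    [/\ m 7 (o + p) = switch n k l p, m 8 (o + p) = target n k false l p &
        m 9 (o + p) = target n k true l p];
  static_residue : forall p, p < n -> m 10 p = p %% r;
  static_edge : forall j, j < #|E| -> exists u v w : 'I_n,
    [/\ enum (nth set0 (enum E) j) = [:: u; v; w], m 0 (3 + 3 * j) = u,
        m 0 (4 + 3 * j) = v & m 0 (5 + 3 * j) = w] }.

Lemma static_agree ws m m' : agree ws m m' ->
  all (fun a => a \notin ws) [:: 0; 4; 5; 6; 7; 8; 9; 10; 26] -> static m -> static m'.
Proof.
move=> A /= /and5P[w0 w4 w5 w6 /and5P[w7 w8 w9 w10 /andP[w26 _]]] [H1 H2 H3 H4 H5 H6 H7 H8].
split; rewrite ?A //.
- by move=> l p pn o; rewrite !A //; apply: H6.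
- by move=> p pn; rewrite A //; apply: H7.
by move=> j jE; have [u [v [w H]]] := H8 j jE; exists u, v, w; rewrite !A.
Qed.

Definition represents m s := forall i, i < M -> m 11 i = code (lookup s i).

Definition erase_path s v : state :=
  [ffun x : 'I_M => if nat_of_ord x == cell s v (x %/ n) then None else s x].

Lemma lookup_erase_path s v i : lookup (erase_path s v) i =
  if i == cell s v (i %/ n) then None else lookup s i.
Proof.
rewrite /lookup; case: insubP => [x _ /= <-|]; last by case: ifP.
by rewrite ffunE.
Qed.

Definition walk_arrays := [:: 11; 15; 16; 17; 18; 19; 22].

Lemma walk_body_spec er m (l := m 22 0) (p := m 15 0)
    (o := if m 4 0 - l != 0 then 0 else m 0 0) (i := m 17 0 + m 7 (o + p))
    (m' := den (walk_body er) m) :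
  [/\ m' 15 0 = (if m 11 i - 1 != 0 then m 9 (o + p) else m 8 (o + p)),
      m' 16 0 = (if m 11 i != 0 then m 16 0 else 1),
      m' 17 0 = m 17 0 + m 0 0,
      forall j, m' 11 j = (if er && (j == i) then 0 else m 11 j) & agree walk_arrays m m'].
Proof.
have A : agree walk_arrays m m'.
  by apply: agree_den; case: (er).
pose m1 := den (PIf (getc 4 :- getc 22) (setc 18 (Const 0)) (setc 18 (getc 0))) m.
have H1 : m1 18 0 = o by rewrite /m1 /o /l /=; case: ifP.
have A1 : agree [:: 18] m m1 by apply: agree_den.
pose m2 := den (setc 19 (getc 17 :+ Get 7 (getc 18 :+ getc 15))) m1.
have H2 : m2 19 0 = i by rewrite /m2 /= /update /= H1 !A1.
have A2 : agree [:: 18; 19] m m2 by apply: agree_trans (agree_den _ (p := setc 19 _) _); [apply: agree_sub A1 => a; rewrite !inE => ->|].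
pose m3 := den (PIf (Get 11 (getc 19)) PSkip (setc 16 (Const 1))) m2.
have H3 : m3 16 0 = (if m 11 i != 0 then m 16 0 else 1).
  by rewrite /m3 /= H2 A2 //; case: ifP => // _; rewrite A2.
have A3 : agree [:: 16] m2 m3 by apply: agree_den.
pose m4 := den (PIf (Get 11 (getc 19) :- Const 1) (setc 15 (Get 9 (getc 18 :+ getc 15))) (setc 15 (Get 8 (getc 18 :+ getc 15)))) m3.
have E18 : m2 18 0 = o by rewrite /m2 /= /update /= H1.
have H4 : m4 15 0 = (if m 11 i - 1 != 0 then m 9 (o + p) else m 8 (o + p)).
  by rewrite /m4 /= !A3 // H2 A2 //; case: ifP => _; rewrite /update /= E18 !A2.
have A4 : agree [:: 15] m3 m4 by apply: agree_den.
pose m5 := den (if er then PPut 11 (getc 19) (Const 0) else PSkip) m4.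
have H5 j : m5 11 j = if er && (j == i) then 0 else m 11 j.
  by rewrite /m5; case: (er) => /=; rewrite /update /= ?[m4 19 0]A4 ?[m3 19 0]A3 ?H2 ?[m4 11 j]A4 ?[m3 11 j]A3 ?A2.
have A5 : agree [:: 11] m4 m5 by apply: agree_den; case: (er).
have Em' : m' = den (setc 17 (getc 17 :+ getc 0)) m5 by [].
by split=> //; rewrite Em' /= /update /= ?H5 // !A5 // ?H4 // !A4 // ?H3 // !A3 // !A2.
Qed.

Lemma walk_spec er m s (ve : expr) v (m' := den (walk_prog er ve) m) :
  static m -> represents m s -> eval m ve = v -> v < n ->
  [/\ m' 15 0 = walk s v K, m' 16 0 = ~~ known s v,
      represents m' (if er then erase_path s v else s) & agree walk_arrays m m'].
Proof.
move=> sm rm Ev vn.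
have A : agree walk_arrays m m' by apply: agree_den; case: (er).
pose P j y := [/\ y 15 0 = walk s v j,
  y 16 0 = ~~ all (fun l => lookup s (cell s v l) != None) (iota 0 j),
  y 17 0 = j * n,
  (forall i, i < M -> y 11 i = if er && (i %/ n < j) && (i == cell s v (i %/ n)) then 0
                               else code (lookup s i)) &
  agree walk_arrays m y /\ y 22 0 = j].
have : P K m'.
  pose m1 := update (update (update m 15 0 v) 16 0 0) 17 0 0.
  have -> : m' = iteri (m1 5 0) (fun j y => update (den (walk_body er) y) 22 0 j.+1) (update m1 22 0 0).
    by rewrite /m1 -Ev.
  have A1 : agree walk_arrays m m1 by do 3?[apply: agree_trans; last exact: agree_update].
  rewrite (_ : m1 5 0 = K); last by rewrite A1 // (static_K sm).
  apply: iteri_inv => [|j y jK [y15 y16 y17 y11 [Ay y22]]].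
    split=> //; last by split=> //; apply: agree_trans A1 _; apply: agree_update.
    by move=> i iM; rewrite /m1 /update /= ltn0 andbF /= rm.
  have wj : walk s v j < n by apply: walk_lt.
  have [] := walk_body_spec er y; set y' := den (walk_body er) y.
  rewrite y22 y15 y17 (Ay 4) // (Ay 0) // (static_k sm) (static_n sm).
  have [] := static_table sm j wj.
  rewrite (_ : (k - j != 0) = (j < k)); last by rewrite subn_eq0 -ltnNge.
  set o := if _ then _ else _.
  rewrite (Ay 7) // (Ay 8) // (Ay 9) // => -> -> ->; rewrite -/(cell s v j).
  have dj : cell s v j %/ n = j by apply: divn_cell.
  (* The cells erased so far lie in earlier layers, so the bit needed now is intact. *)
  have -> : y 11 (cell s v j) = code (lookup s (cell s v j)).
    by rewrite y11 ?cell_lt // dj ltnn andbF.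
  have allS (f : pred nat) : all f (iota 0 j.+1) = all f (iota 0 j) && f j.
    by rewrite -addn1 iotaD all_cat /= andbT.
  move=> z15 z16 z17 z11 Az.
  split; rewrite /update /=.
  - by rewrite z15 /= -/(cell s v j); case: (lookup _ _) => [[]|].
  - have /= -> := allS (fun l => lookup s (cell s v l) != None).
    rewrite z16 y16; case: (lookup _ _) => [[]|] /=.
    + by rewrite andbT.
    + by rewrite andbT.
    by rewrite andbF.
  - by rewrite z17 mulSn addnC.
  - move=> i iM; rewrite z11 y11 //; case: (er) => //=.
    have [->|ne] := eqVneq i (cell s v j).
      by rewrite dj ltnSn eqxx.
    have -> : (i %/ n < j.+1) = (i %/ n == j) || (i %/ n < j) by rewrite ltnS leq_eqVlt.
    by case: (i %/ n =P j) => [->|] //=; rewrite (negbTE ne) andbF.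
  by split=> //; apply: agree_trans Ay (agree_trans Az _); apply: agree_update.
move=> [z15 z16 z17 z11 _]; split=> // i iM.
by rewrite z11 // ltn_divLR // iM andbT; case: (er) => //=; rewrite lookup_erase_path; case: ifP.
Qed.

Definition color_arrays := [:: 1; 20; 21] ++ walk_arrays.

Definition colors m s :=
  forall v, v < n -> m 1 v = color r s v /\ m 20 v = ~~ known s v.

Lemma color_spec m s (m' := den color_prog m) :
  static m -> represents m s ->
  [/\ colors m' s, represents m' s & agree color_arrays m m'].
Proof.
move=> sm rm.
pose body := walk_prog false (getc 21) ;; PPut 1 (getc 21) (Get 10 (getc 15)) ;; PPut 20 (getc 21) (getc 16).
pose P j y := [/\ forall v, v < j -> y 1 v = color r s v /\ y 20 v = ~~ known s v,
  represents y s, agree color_arrays m y & y 21 0 = j].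
suff [] : P n m' by split.
have -> : m' = iteri n (fun j y => update (den body y) 21 0 j.+1) (update m 21 0 0).
  by rewrite -(static_n sm).
apply: iteri_inv => [|j y jn [yc ry Ay y21]]; first by split=> //; apply: agree_update.
have sy : static y by apply: static_agree Ay _ sm.
pose y1 := den (walk_prog false (getc 21)) y.
have [y15 y16 y11 A1] := walk_spec false sy ry (erefl (eval y (getc 21))) (etrans (congr1 (fun x => x < n) y21) jn).
rewrite -/y1 /= y21 in y15 y16 y11 A1.
have E1 : den body y = update (update y1 1 (y1 21 0) (y1 10 (y1 15 0))) 20 (y1 21 0) (y1 16 0) by [].
rewrite E1 A1 // y21 y15 y16 A1 // (static_residue sy) ?walk_lt // -/(color r s j).
split.
- move=> v; rewrite ltnS leq_eqVlt /update /= => /predU1P[->|vj]; first by rewrite eqxx.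
  by rewrite (ltn_eqF vj) !A1 //; apply: yc.
- by move=> i iM; rewrite /update /= y11.
- apply: agree_trans Ay _; apply: agree_trans (agree_trans (agree_trans _ (agree_update _ _ _ _)) (agree_update _ _ _ _)) (agree_update _ _ _ _) => //.
  by apply: agree_sub A1 => a aw; rewrite /color_arrays mem_cat aw orbT.
by [].
Qed.

Lemma bad_exprP m s j u v w : colors m s -> m 23 0 = j ->
  m 0 j = u -> m 0 (j + 1) = v -> m 0 (j + 2) = w -> u < n -> v < n -> w < n ->
  (eval m bad_expr == 0) = [&& known s u, known s v, known s w, color r s u == color r s v & color r s u == color r s w].
Proof.
move=> cm Ej Eu Ev Ew un vn wn.
rewrite /= Ej Eu Ev Ew.
have [-> ->] := cm u un; have [-> ->] := cm v vn; have [-> ->] := cm w wn.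
rewrite !addn_eq0 !eqb0 !negbK -!andbA; do 3!congr (_ && _).
by rewrite !subn_eq0 !eqn_leq !andbA.
Qed.

Lemma bad_enum s (e : {set 'I_n}) (u v w : 'I_n) : enum e = [:: u; v; w] ->
  bad r s e = [&& known s u, known s v, known s w, color r s u == color r s v & color r s u == color r s w].
Proof.
move=> Ee; have me x : (x \in e) = (x \in [:: u; v; w]) by rewrite -Ee mem_enum.
apply/badP/and5P => [[Hk Hc]|[ku kv kw /eqP cv /eqP cw]].
  by split; try (apply: Hk; rewrite me !inE eqxx ?orbT //); apply/eqP/Hc; rewrite me !inE eqxx ?orbT.
split=> [x|x z]; first by rewrite me !inE => /or3P[] /eqP ->.
by rewrite !me !inE => /or3P[] /eqP -> /or3P[] /eqP ->; rewrite -?cv -?cw.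
Qed.

Definition edge_at m (o : option {set 'I_n}) (i : nat) : Prop :=
  if o is Some e then exists u v w : 'I_n,
    [/\ enum e = [:: u; v; w], i != 0, m 0 i = u, m 0 (i + 1) = v & m 0 (i + 2) = w]
  else i = 0.

Lemma edge_at_agree ws m m' o i : agree ws m m' -> 0 \notin ws -> edge_at m o i -> edge_at m' o i.
Proof.
case: o => // e A w0 [u [v [w [Ee i0 mu mv mw]]]].
by exists u, v, w; rewrite !A.
Qed.

Lemma find_spec m s (m' := den find_prog m) : static m -> colors m s ->
  edge_at m (found r E s) (m' 14 0) /\ agree [:: 14; 21; 23] m m'.
Proof.
move=> sm cm.
have A : agree [:: 14; 21; 23] m m' by apply: agree_den.
split=> //.
pose f (o : option {set 'I_n}) e := if bad r s e then Some e else o.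
pose Q := edge_at m.
pose P j y := [/\ Q (foldl f None (take j (enum E))) (y 14 0), y 23 0 = 3 + 3 * j,
  agree [:: 14; 21; 23] m y & y 21 0 = j].
pose body := PIf bad_expr PSkip (setc 14 (getc 23)) ;; setc 23 (getc 23 :+ Const 3).
suff [HQ _ _ _] : P #|E| m'.
  by move: HQ; rewrite /found cardE take_size.
have -> : m' = iteri #|E| (fun j y => update (den body y) 21 0 j.+1)
    (update (update (update m 14 0 0) 23 0 3) 21 0 0).
  by rewrite -(static_E sm).
apply: iteri_inv => [|j y jE [yQ y23 Ay y21]].
  split=> //; first by rewrite take0.
  by do 3?[apply: agree_trans; last exact: agree_update].
have cy : colors y s by move=> v vn; rewrite !Ay //; apply: cm.
have [u [v [w [Ee mu mv mw]]]] := static_edge sm jE.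
rewrite cardE in jE.
rewrite /P (take_nth set0 jE) -cats1 foldl_cat.
set e := nth set0 _ _ in Ee *.
have mv' : y 0 (3 + 3 * j + 1) = v by rewrite Ay // -mv; congr (m 0 _); lia.
have mw' : y 0 (3 + 3 * j + 2) = w by rewrite Ay // -mw; congr (m 0 _); lia.
have mu' : y 0 (3 + 3 * j) = u by rewrite Ay.
have := bad_exprP cy y23 mu' mv' mw' (ltn_ord u) (ltn_ord v) (ltn_ord w).
rewrite -(bad_enum s Ee) => be.
pose y1 := den (PIf bad_expr PSkip (setc 14 (getc 23))) y.
have Ey1 : y1 = if bad r s e then update y 14 0 (3 + 3 * j) else y.
  by rewrite /y1 -y23 -be /=; case: eqP.
have A1 : agree [:: 14] y y1 by apply: agree_den.
have Eb : den body y = update y1 23 0 (y1 23 0 + 3) by [].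
rewrite Eb; split; rewrite /update /=.
- rewrite Ey1 /f; case: ifP => _ //; rewrite /update /= /Q /edge_at.
  exists u, v, w; split=> //.
  + by rewrite -mv; congr (m 0 _); lia.
  + by rewrite -mw; congr (m 0 _); lia.
- by rewrite A1 // y23; lia.
- apply: agree_trans Ay _; apply: agree_trans (agree_trans _ (agree_update _ _ _ _)) (agree_update _ _ _ _) => //.
  by apply: agree_sub A1 => a; rewrite !inE => ->.
by [].
Qed.

Lemma cell_erase_path s u v : v < n -> (forall j, cell s v j != cell s u j) ->
  forall l, cell (erase_path s u) v l = cell s v l.
Proof.
move=> vn H l; rewrite {1}/cell (eq_walk (s := s)) // => j _.
by rewrite lookup_erase_path divn_cell // (negbTE (H j)).
Qed.

(** The second and third walk run on an assignment that is already reduced. Disjointness of the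
    paths of a bad edge keeps these walks unchanged. *)
Lemma erase_bad s (e : {set 'I_n}) (u v w : 'I_n) : bad r s e -> enum e = [:: u; v; w] ->
  erase_path (erase_path (erase_path s u) v) w = erase s (support (restrict s e)).
Proof.
move=> be Ee; have me x : (x \in e) = (x \in [:: u; v; w]) by rewrite -Ee mem_enum.
have := enum_uniq e; rewrite Ee /= !inE negb_or andbT => /andP[/andP[uv uw] vw].
have D x z j : x \in e -> z \in e -> x != z -> cell s x j != cell s z j.
  by move=> xe ze; apply: contra_neq => /(bad_cell_inj k0 kn kr be xe ze).
have [ue ve we] : [/\ u \in e, v \in e & w \in e] by rewrite !me !inE !eqxx !orbT.
have Cv := cell_erase_path (ltn_ord v) (fun j => D v u j ve ue (introN eqP (fun H => negP uv (introT eqP (esym H))))).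
have Cw := cell_erase_path (ltn_ord w) (fun j => D w u j we ue (introN eqP (fun H => negP uw (introT eqP (esym H))))).
have Cw2 l : cell (erase_path (erase_path s u) v) w l = cell s w l.
  by rewrite cell_erase_path // => j; rewrite Cw Cv D // eq_sym.
apply/ffunP=> x; rewrite !ffunE inE ffunE Cw2 Cv.
have Ex : [exists z in e, nat_of_ord x == cell s z (x %/ n)] =
   [|| nat_of_ord x == cell s u (x %/ n), nat_of_ord x == cell s v (x %/ n) | nat_of_ord x == cell s w (x %/ n)].
  apply/exists_inP/or3P => [[z]|].
    by rewrite me !inE => /or3P[] /eqP -> H; [apply: Or31|apply: Or32|apply: Or33].
  by case=> H; [exists u | exists v | exists w].
rewrite Ex; case: (_ == cell s w _) => /=; rewrite ?orbT.
  by case: (s x).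
by case: (_ == cell s v _) => /=; rewrite ?orbT ?orbF; case: (_ == cell s u _) => //=; case: (s x).
Qed.

Lemma erase_spec m s (m' := den erase_prog m) : static m -> represents m s ->
  edge_at m (found r E s) (m 14 0) ->
  represents m' (prune (bad_choice r E) s) /\ agree walk_arrays m m'.
Proof.
move=> sm rm H; split; last by apply: agree_den.
move: H; rewrite /prune /bad_choice; have := foundP r E s.
pose p1 := walk_prog true (Get 0 (getc 14)).
pose p2 := walk_prog true (Get 0 (getc 14 :+ Const 1)).
pose p3 := walk_prog true (Get 0 (getc 14 :+ Const 2)).
have -> : m' = if m 14 0 != 0 then den p3 (den p2 (den p1 m)) else m by [].
case: found => [e [eE be] [u [v [w [Ee -> mu mv mw]]]]|_ ->]; last by [].
suff : represents (den p3 (den p2 (den p1 m))) (erase s (support (restrict s e))) by [].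
rewrite -(erase_bad be Ee).
have mu1 : eval m (Get 0 (getc 14)) = u by [].
have [_ _ r1 A1] := walk_spec true sm rm mu1 (ltn_ord u).
rewrite -/p1 in r1 A1; move: (den p1 m) r1 A1 => m1 r1 A1.
have s1 : static m1 by apply: static_agree A1 _ sm.
have mv1 : eval m1 (Get 0 (getc 14 :+ Const 1)) = v by rewrite /= !A1.
have [_ _ r2 A2] := walk_spec true s1 r1 mv1 (ltn_ord v).
rewrite -/p2 in r2 A2; move: (den p2 m1) r2 A2 => m2 r2 A2.
have s2 : static m2 by apply: static_agree A2 _ s1.
have mw2 : eval m2 (Get 0 (getc 14 :+ Const 2)) = w by rewrite /= !A2 // !A1.
by have [_ _ r3 A3] := walk_spec true s2 r2 mw2 (ltn_ord w).
Qed.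

Definition selection s := last 0 [seq i.+1 | i <- iota 0 M & lookup s i == None].

Lemma selectionE s : selection s =
  if complete_assignment s then 0 else (last_unassigned k0 kn (support s)).+1.
Proof.
rewrite /selection /last_unassigned.
have -> : [seq i <- iota 0 M | lookup s i == None] = map val [seq x <- enum 'I_M | x \notin support s].
  rewrite -val_enum_ord filter_map; congr map; apply: eq_filter => x /=.
  by rewrite lookup_val inE negbK.
have [cs|cs] := boolP (complete_assignment s).
  rewrite (_ : [seq x <- _ | _] = [::]) //; apply/eqP; rewrite -[_ == _]negbK -has_filter.
  apply/hasPn=> x _; by rewrite (eqP cs) inE.
have [x xs] : exists x, x \notin support s.
  by move: cs; rewrite /complete_assignment -subTset => /subsetPn[x _ xs]; exists x.
have : x \in [seq x <- enum 'I_M | x \notin support s] by rewrite mem_filter xs mem_enum.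
by case: [seq x <- _ | _] => // z zs _; rewrite /= -map_comp (last_map (S \o val)).
Qed.

Lemma select_spec m s (m' := den select_prog m) : static m -> represents m s ->
  m' 13 0 = selection s /\ agree [:: 13; 21] m m'.
Proof.
move=> sm rm; split; last exact: agree_den.
pose P j y := [/\ y 13 0 = last 0 [seq i.+1 | i <- iota 0 j & lookup s i == None],
  agree [:: 13; 21] m y & y 21 0 = j].
pose body := PIf (Get 11 (getc 21)) PSkip (setc 13 (getc 21 :+ Const 1)).
suff [] : P M m' by [].
have -> : m' = iteri M (fun j y => update (den body y) 21 0 j.+1)
    (update (update m 13 0 0) 21 0 0).
  by rewrite -(static_M sm).
apply: iteri_inv => [|j y jM [y13 Ay y21]].
  by split=> //; do 2?[apply: agree_trans; last exact: agree_update].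
have Ab : agree [:: 13] y (den body y) by apply: agree_den.
split=> //.
  rewrite -[j.+1]addn1 iotaD filter_cat map_cat last_cat -y13 add0n [RHS]/=.
  rewrite /update [LHS]/= y21 Ay // rm //; case: (lookup s j) => [b|] //=.
  by rewrite /update /= addn1.
apply: agree_trans Ay _; apply: agree_trans (agree_update _ _ _ _) => //.
by apply: agree_sub Ab => a; rewrite !inE => ->.
Qed.

Lemma search_spec m s (b : bool) (m' := den search_prog m)
    (s' := search (last_unassigned k0 kn) (bad_choice r E) s b) :
  static m -> represents m s -> m 13 0 = selection s -> m 12 0 = b ->
  ~~ complete_assignment s ->
  [/\ static m', represents m' s' & m' 13 0 = selection s'].
Proof.
move=> sm rm m13 m12 ncs.
set x := last_unassigned k0 kn (support s).
have Ex : m 13 0 - 1 = x by rewrite m13 selectionE (negbTE ncs) subn1.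
pose m1 := update m 11 x b.+1; pose s1 := assign s x b.
have Em' : m' = den select_prog (den erase_prog (den find_prog (den color_prog m1))).
  have -> : m1 = update m 11 (m 13 0 - 1) (m 12 0 + 1) by rewrite Ex m12 addn1.
  by [].
have r1 : represents m1 s1.
  move=> i iM; rewrite /m1 /update /= rm //; rewrite /lookup.
  case: insubP => [z _ /= Ez|]; last by rewrite iM.
  by rewrite ffunE -Ez -(inj_eq val_inj); case: eqP.
have A1 : agree [:: 11] m m1 by apply: agree_update.
have sm1 : static m1 by apply: static_agree A1 _ sm.
rewrite Em'; move: m1 {Em'} r1 A1 sm1 => m1 r1 A1 sm1.
have [c2 r2 A2] := color_spec sm1 r1; move: (den color_prog m1) c2 r2 A2 => m2 c2 r2 A2.
have sm2 : static m2 by apply: static_agree A2 _ sm1.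
have [f3 A3] := find_spec sm2 c2; move: (den find_prog m2) f3 A3 => m3 f3 A3.
have sm3 : static m3 by apply: static_agree A3 _ sm2.
have r3 : represents m3 s1 by move=> i iM; rewrite A3 //; apply: r2.
have {}f3 := edge_at_agree A3 (erefl _) f3.
have [r4 A4] := erase_spec sm3 r3 f3; move: (den erase_prog m3) r4 A4 => m4 r4 A4.
have sm4 : static m4 by apply: static_agree A4 _ sm3.
have [m13' A5] := select_spec sm4 r4.
split=> //; first by apply: static_agree A5 _ sm4.
by move=> i iM; rewrite A5 //; apply: r4.
Qed.

End Spec.

(** * Precomputation *)

(** Doubles 2^j as long as 2^(j+2) <= r, and array 3 keeps the previous power. Since k <= n, a loop
    of [n] rounds suffices; the late rounds are idle. *)
Definition size_prog : prog :=
  setc 2 (Const 1) ;; setc 4 (Const 0) ;;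
  PFor 21 0 (PIf (Get 0 (Const 1) :+ Const 1 :- (getc 2 :+ getc 2 :+ getc 2 :+ getc 2))
               (setc 3 (getc 2) ;; setc 2 (getc 2 :+ getc 2) ;; setc 4 (getc 4 :+ Const 1)) PSkip) ;;
  setc 5 (getc 4 :+ getc 4) ;; setc 26 (Get 0 (Const 2)).

Definition fill_prog (idx rel act : expr) : prog :=
  PIf act
    (PIf (getc 3 :- rel)
       (PPut 7 idx (getc 21) ;; PPut 8 idx (getc 21 :+ rel) ;; PPut 9 idx (getc 21 :+ rel :+ Const 1))
       (PPut 7 idx (getc 21 :- getc 3) ;; PPut 8 idx (getc 21 :+ rel :- getc 2 :+ Const 1) ;;
        PPut 9 idx (getc 21 :+ rel :- getc 2)))
    (PPut 7 idx (getc 21) ;; PPut 8 idx (getc 21) ;; PPut 9 idx (getc 21)).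

(* 24 and 25 count modulo 2^k and modulo r. *)
Definition table_body : prog :=
  fill_prog (getc 21) (getc 24) (getc 0 :+ Const 1 :+ getc 24 :- (getc 21 :+ getc 2)) ;;
  fill_prog (getc 0 :+ getc 21) (getc 21 :+ getc 2 :- getc 0) (getc 21 :+ getc 2 :+ Const 1 :- getc 0) ;;
  PPut 10 (getc 21) (getc 25) ;;
  setc 25 (getc 25 :+ Const 1) ;; PIf (Get 0 (Const 1) :- getc 25) PSkip (setc 25 (Const 0)) ;;
  setc 24 (getc 24 :+ Const 1) ;; PIf (getc 2 :- getc 24) PSkip (setc 24 (Const 0)).

Definition table_prog : prog :=
  setc 6 (Const 0) ;; PFor 21 5 (setc 6 (getc 6 :+ getc 0)) ;;
  setc 24 (Const 0) ;; setc 25 (Const 0) ;; PFor 21 0 table_body.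

(** The expressions are evaluated again between the writes, so the hypothesis covers every memory
    that differs in the three tables only. *)
Lemma fill_spec idx rel act m i rho (a : bool) :
  (forall m', agree [:: 7; 8; 9] m m' -> [/\ eval m' idx = i, eval m' rel = rho & (eval m' act != 0) = a]) ->
  let m' := den (fill_prog idx rel act) m in
  [/\ forall j, m' 7 j = if j == i then (if a then (if m 3 0 <= rho then m 21 0 - m 3 0 else m 21 0) else m 21 0)
        else m 7 j,
      forall (b : bool) j, m' (if b then 9 else 8) j = if j == i then
        (if a then m 21 0 + rho - (if rho < m 3 0 then 0 else m 2 0) + (b (+) (m 3 0 <= rho)) else m 21 0)
        else m (if b then 9 else 8) j &
      agree [:: 7; 8; 9] m m'].
Proof.
move=> H m'; have A : agree [:: 7; 8; 9] m m' by apply: agree_den.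
have Am : agree [:: 7; 8; 9] m m by [].
have w (m1 : memory) b j x : b \in [:: 7; 8; 9] -> agree [:: 7; 8; 9] m m1 -> agree [:: 7; 8; 9] m (update m1 b j x).
  by move=> bw A1; apply: agree_trans A1 (agree_update _ _ _ bw).
have put e1 e2 e3 :
    (forall m1, agree [:: 7; 8; 9] m m1 -> eval m1 e2 = eval m e2 /\ eval m1 e3 = eval m e3) ->
    den (PPut 7 idx e1 ;; PPut 8 idx e2 ;; PPut 9 idx e3) m =
    update (update (update m 7 i (eval m e1)) 8 i (eval m e2)) 9 i (eval m e3).
  move=> He.
  have -> : den (PPut 7 idx e1 ;; PPut 8 idx e2 ;; PPut 9 idx e3) m =
    let m1 := update m 7 (eval m idx) (eval m e1) in
    let m2 := update m1 8 (eval m1 idx) (eval m1 e2) in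
    update m2 9 (eval m2 idx) (eval m2 e3) by [].
  have [-> _ _] := H m Am.
  set m1' := update m 7 i _.
  have A1' : agree [:: 7; 8; 9] m m1' by apply: w.
  have [E1 _ _] := H _ A1'; have [E2 _] := He _ A1'.
  rewrite /= E1 E2; set m2' := update m1' 8 i _.
  have A2' : agree [:: 7; 8; 9] m m2' by apply: w.
  by have [-> _ _] := H _ A2'; have [_ ->] := He _ A2'.
have [Ei Er Ea] := H m Am.
pose tgt b := if a then m 21 0 + rho - (if rho < m 3 0 then 0 else m 2 0) + (b (+) (m 3 0 <= rho)) else m 21 0.
have Em' : m' = update (update (update m 7 i
    (if a then (if m 3 0 <= rho then m 21 0 - m 3 0 else m 21 0) else m 21 0)) 8 i (tgt false)) 9 i (tgt true).
  have -> : m' = if eval m act != 0 then if eval m (getc 3 :- rel) != 0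
     then den (PPut 7 idx (getc 21) ;; PPut 8 idx (getc 21 :+ rel) ;; PPut 9 idx (getc 21 :+ rel :+ Const 1)) m
     else den (PPut 7 idx (getc 21 :- getc 3) ;; PPut 8 idx (getc 21 :+ rel :- getc 2 :+ Const 1) ;;
        PPut 9 idx (getc 21 :+ rel :- getc 2)) m
     else den (PPut 7 idx (getc 21) ;; PPut 8 idx (getc 21) ;; PPut 9 idx (getc 21)) m by [].
  rewrite Ea /tgt; case: (a); last first.
    by rewrite put => [|m1 A1]; rewrite /= ?A1.
  rewrite [eval m (_ :- _)]/= Er subn_eq0 -ltnNge.
  have EE m1 : agree [:: 7; 8; 9] m m1 -> eval m1 rel = eval m rel.
    by case/H => _ -> _; rewrite Er.
  case: (ltnP rho (m 3 0)) => Hr.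
    by rewrite put => [|m1 A1]; rewrite /= ?EE ?A1 // ?Er subn0 addn0.
  by rewrite put => [|m1 A1]; rewrite /= ?EE ?A1 // ?Er addn0.
split=> //; first by move=> j; rewrite Em' /update /=.
by case=> j; rewrite Em' /update /=.
Qed.

(** * Correctness of the precomputation *)

Section Setup.
Variables (n r k : nat) (E : {set {set 'I_n}}).
Hypothesis k0 : 0 < k.
Hypothesis kn : 2 ^ k <= n.
Hypothesis kr : 2 ^ k.+1 <= r.
Hypothesis rk : r < 2 ^ k.+2.
Hypothesis E3 : forall e, e \in E -> #|e| = 3.

Let sz0 : 0 < 2 ^ k. Proof. by rewrite expn_gt0. Qed.

Lemma size_spec m (m' := den size_prog m) : m 0 0 = n -> m 0 1 = r ->
  [/\ m' 2 0 = 2 ^ k, m' 3 0 = half k, m' 4 0 = k, m' 5 0 = k + k &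
   m' 26 0 = m 0 2 /\ agree [:: 2; 3; 4; 5; 21; 26] m m'].
Proof.
move=> mn mr.
pose body := PIf (Get 0 (Const 1) :+ Const 1 :- (getc 2 :+ getc 2 :+ getc 2 :+ getc 2))
               (setc 3 (getc 2) ;; setc 2 (getc 2 :+ getc 2) ;; setc 4 (getc 4 :+ Const 1)) PSkip.
pose P j y := [/\ y 2 0 = 2 ^ minn j k, (0 < j -> y 3 0 = half (minn j k)), y 4 0 = minn j k &
  agree [:: 2; 3; 4; 5; 21; 26] m y].
pose y := iteri n (fun j y => update (den body y) 21 0 j.+1)
    (update (update (update m 2 0 1) 4 0 0) 21 0 0).
have Em' : m' = den (setc 5 (getc 4 :+ getc 4) ;; setc 26 (Get 0 (Const 2))) y.
  by rewrite /y -mn.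
have kn' : k <= n by apply: leq_trans kn; apply/ltnW/ltn_expl.
have Ej j : (r + 1 - (2 ^ minn j k + 2 ^ minn j k + 2 ^ minn j k + 2 ^ minn j k) != 0) = (j < k).
  rewrite subn_eq0 addn1 -ltnNge ltnS (_ : _ + _ = 2 ^ (minn j k).+2); last by rewrite !expnS; lia.
  have [jk|jk] := ltnP j k; first by apply: leq_trans kr; rewrite leq_exp2l.
  by apply/negbTE; rewrite -ltnNge.
have Em j : minn j.+1 k = if j < k then (minn j k).+1 else minn j k.
  by have [jk|jk] := ltnP j k; [apply/minn_idPl | apply/minn_idPr/ltnW].
have [] : P n y.
{ apply: iteri_inv => [|j z jn [z2 z3 z4 Az]].
    split; rewrite ?min0n //.
    by do 3?[apply: agree_trans; last exact: agree_update].
  have Ab : agree [:: 2; 3; 4; 5; 21; 26] z (update (den body z) 21 0 j.+1).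
    by apply: agree_trans (agree_update _ _ _ _) => //; apply: agree_den.
  split; last exact: agree_trans Az Ab.
  all: rewrite /update /= (Az 0) // mr z2 Ej Em.
  - by case: (j < k); rewrite /update /= z2 // expnS; lia.
  - move=> _; case: ifP => jk; rewrite /update /= ?z2 //.
    by apply: z3; apply: leq_trans k0 _; rewrite leqNgt jk.
  by case: (j < k); rewrite /update /= z4 // addn1. }
rewrite (minn_idPr kn') => y2 y3 y4 Ay.
rewrite Em' /= /update /=; split=> //.
- by rewrite y3 // (leq_trans k0).
- by rewrite y4.
split; first by rewrite Ay.
by apply: agree_trans (agree_trans Ay (agree_update _ _ _ _)) (agree_update _ _ _ _).
Qed.

Lemma modnS_small p q : 0 < q -> p.+1 %% q = if (p %% q).+1 < q then (p %% q).+1 else 0.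
Proof.
move=> q0; have := ltn_pmod p q0; rewrite -[in LHS](addn1 p) -modnDml addn1 => pq.
case: ltnP => H; first by rewrite modn_small.
by rewrite (_ : (p %% q).+1 = q) ?modnn //; apply/eqP; rewrite eqn_leq H pq.
Qed.

Lemma table_body_spec m p (m' := den table_body m) : p < n ->
  m 0 0 = n -> m 0 1 = r -> m 2 0 = 2 ^ k -> m 3 0 = half k ->
  m 21 0 = p -> m 24 0 = p %% 2 ^ k -> m 25 0 = p %% r ->
  [/\ forall j, m' 7 j = if j == n + p then switch n k k p else if j == p then switch n k 0 p else m 7 j,
      forall (b : bool) j, m' (if b then 9 else 8) j =
        if j == n + p then target n k b k p else if j == p then target n k b 0 p else m (if b then 9 else 8) j,
      forall j, m' 10 j = if j == p then p %% r else m 10 j,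
      m' 24 0 = p.+1 %% 2 ^ k /\ m' 25 0 = p.+1 %% r &
      agree [:: 7; 8; 9; 10; 24; 25] m m'].
Proof.
move=> pn mn mr m2 m3 m21 m24 m25.
have r0 : 0 < r by rewrite (leq_trans _ kr) // expn_gt0.
have A : agree [:: 7; 8; 9; 10; 24; 25] m m' by apply: agree_den.
pose f1 := fill_prog (getc 21) (getc 24) (getc 0 :+ Const 1 :+ getc 24 :- (getc 21 :+ getc 2)).
pose f2 := fill_prog (getc 0 :+ getc 21) (getc 21 :+ getc 2 :- getc 0) (getc 21 :+ getc 2 :+ Const 1 :- getc 0).
pose rest := PPut 10 (getc 21) (getc 25) ;;
  setc 25 (getc 25 :+ Const 1) ;; PIf (Get 0 (Const 1) :- getc 25) PSkip (setc 25 (Const 0)) ;;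
  setc 24 (getc 24 :+ Const 1) ;; PIf (getc 2 :- getc 24) PSkip (setc 24 (Const 0)).
have Em' : m' = den rest (den f2 (den f1 m)) by [].
have [|F7 Fb AF] := @fill_spec (getc 21) (getc 24) (getc 0 :+ Const 1 :+ getc 24 :- (getc 21 :+ getc 2)) m
   p (offset n k 0 p) (active n k 0 p).
  move=> y Ay; rewrite /= !Ay // m21 mn m24 m2 /offset /active k0; split=> //.
  by rewrite subn_eq0 -ltnNge; have := leq_mod p (2 ^ k); lia.
rewrite -/f1 in F7 Fb AF; move: (den f1 m) F7 Fb AF Em' => m1 F7 Fb AF Em'.
have [|G7 Gb AG] := @fill_spec (getc 0 :+ getc 21) (getc 21 :+ getc 2 :- getc 0) (getc 21 :+ getc 2 :+ Const 1 :- getc 0) m1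
   (n + p) (offset n k k p) (active n k k p).
  move=> y Ay; rewrite /= !Ay // !AF // m21 mn m2 /offset /active ltnn; split=> //.
  by rewrite subn_eq0 -ltnNge; lia.
rewrite -/f2 in G7 Gb AG; move: (den f2 m1) G7 Gb AG Em' => m2' G7 Gb AG Em'.
have A2 : agree [:: 7; 8; 9] m m2' by apply: agree_trans AF AG.
have A3 : agree [:: 10; 24; 25] m2' m' by rewrite Em'; apply: agree_den.
split=> //.
- move=> j; rewrite A3 // G7 F7 !(AF 3) // !(AF 21) // m3 m21.
  by rewrite /switch.
- move=> b j; rewrite A3; last by case: (b).
  by rewrite Gb Fb !(AF 3) // !(AF 21) // (AF 2) // m3 m21 m2 /target.
- move=> j; rewrite Em' /rest /=; by do 2 case: ifP => _; rewrite /update /= !A2 // m21 m25.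
rewrite Em' /rest.
pose m3' := update m2' 10 (m2' 21 0) (m2' 25 0).
pose m4 := update m3' 25 0 (m3' 25 0 + 1).
have -> : den (PPut 10 (getc 21) (getc 25) ;;
  setc 25 (getc 25 :+ Const 1) ;; PIf (Get 0 (Const 1) :- getc 25) PSkip (setc 25 (Const 0)) ;;
  setc 24 (getc 24 :+ Const 1) ;; PIf (getc 2 :- getc 24) PSkip (setc 24 (Const 0))) m2' =
  den (setc 24 (getc 24 :+ Const 1) ;; PIf (getc 2 :- getc 24) PSkip (setc 24 (Const 0)))
   (if m4 0 1 - m4 25 0 != 0 then m4 else update m4 25 0 0) by [].
have E1 : m4 0 1 = r by rewrite /m4 /m3' /update /= A2.
have E25 : m4 25 0 = (p %% r).+1 by rewrite /m4 /m3' /update /= A2 // m25 addn1.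
rewrite E1 E25.
have E24 (y : memory) : y 2 0 = 2 ^ k -> y 24 0 = p %% 2 ^ k ->
  let z := den (setc 24 (getc 24 :+ Const 1) ;; PIf (getc 2 :- getc 24) PSkip (setc 24 (Const 0))) y in
  z 24 0 = p.+1 %% 2 ^ k /\ z 25 0 = y 25 0.
  move=> y2 y24; rewrite /= /update /= y2 y24 modnS_small // subn_eq0 -ltnNge addn1.
  by case: ifP => H /=; rewrite ?y24.
set y := if _ then _ else _.
have [] := E24 y.
- by rewrite /y; case: ifP => _; rewrite /m4 /m3' /update /= A2.
- by rewrite /y; case: ifP => _; rewrite /m4 /m3' /update /= A2.
move=> -> ->; split=> //.
rewrite modnS_small // /y subn_eq0 -ltnNge; case: ifP => _; rewrite ?E25 // /update.
Qed.

Lemma switch_phase l p : switch n k l p = switch n k (if l < k then 0 else k) p.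
Proof. by rewrite /switch /active /offset; case: (ltnP l k) => _; rewrite ?k0 ?ltnn. Qed.

Lemma target_phase b l p : target n k b l p = target n k b (if l < k then 0 else k) p.
Proof. by rewrite /target /active /offset; case: (ltnP l k) => _; rewrite ?k0 ?ltnn. Qed.

Lemma table_spec m (m' := den table_prog m) :
  m 0 0 = n -> m 0 1 = r -> m 2 0 = 2 ^ k -> m 3 0 = half k -> m 4 0 = k -> m 5 0 = k + k ->
  m 26 0 = #|E| ->
  (forall j, j < #|E| -> exists u v w : 'I_n,
    [/\ enum (nth set0 (enum E) j) = [:: u; v; w], m 0 (3 + 3 * j) = u,
        m 0 (4 + 3 * j) = v & m 0 (5 + 3 * j) = w]) ->
  static r k E m' /\ agree [:: 6; 7; 8; 9; 10; 21; 24; 25] m m'.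
Proof.
move=> mn mr m2 m3 m4 m5 m26 mE.
have A : agree [:: 6; 7; 8; 9; 10; 21; 24; 25] m m' by apply: agree_den.
pose y0 := den (setc 6 (Const 0) ;; PFor 21 5 (setc 6 (getc 6 :+ getc 0))) m.
have y06 : y0 6 0 = (k + k) * n.
  pose P j y := y 6 0 = j * n /\ agree [:: 6; 21] m y.
  have [] : P (k + k) y0.
  { have -> : y0 = iteri (k + k) (fun j y => update (update y 6 0 (y 6 0 + y 0 0)) 21 0 j.+1)
      (update (update m 6 0 0) 21 0 0) by rewrite -m5.
    apply: iteri_inv => [|j z jn [z6 Az]].
      by split=> //; do 2?[apply: agree_trans; last exact: agree_update].
    split; first by rewrite /update /= z6 Az // mn mulSn addnC.
    by apply: agree_trans Az (agree_trans (agree_update _ _ _ _) (agree_update _ _ _ _)). }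
  by [].
have A0 : agree [:: 6; 21] m y0 by apply: agree_den.
pose y1 := update (update (update y0 24 0 0) 25 0 0) 21 0 0.
have Em' : m' = iteri n (fun j y => update (den table_body y) 21 0 j.+1) y1.
  have -> : m' = iteri (y0 0 0) (fun j y => update (den table_body y) 21 0 j.+1) y1 by [].
  by rewrite A0 // mn.
pose ph l := if l < k then 0 else n.
pose P p y := [/\ forall l q, q < p -> y 7 (ph l + q) = switch n k l q /\
      forall b : bool, y (if b then 9 else 8) (ph l + q) = target n k b l q,
   forall q, q < p -> y 10 q = q %% r,
   y 24 0 = p %% 2 ^ k, y 25 0 = p %% r & y 21 0 = p /\ agree [:: 7; 8; 9; 10; 21; 24; 25] y0 y].
have [T7 T10 _ _ [_ A1]] : P n m'.
{ rewrite Em'; apply: iteri_inv => [|p y pn [y7 y10 y24 y25 [y21 Ay]]].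
    split; rewrite ?mod0n //; split=> //.
    by do 3?[apply: agree_trans; last exact: agree_update].
  have [|||||||z7 zb z10 [z24 z25] Az] := @table_body_spec y p pn.
  1-7: by rewrite // ?(Ay 0) ?(Ay 2) ?(Ay 3) // A0.
  change (P p.+1 (update (den table_body y) 21 0 p.+1)).
  move: (den table_body y) z7 zb z10 z24 z25 Az => z z7 zb z10 z24 z25 Az.
  split; rewrite /update /= ?z24 ?z25 //; last first.
    split=> //; apply: agree_trans Ay _; apply: agree_trans (agree_update _ _ _ _) => //.
    apply: agree_sub Az => a; rewrite !inE.
    by do 5 (case/orP=> [->|]; rewrite ?orbT //); move=> ->; rewrite !orbT.
  - move=> q; rewrite ltnS leq_eqVlt z10 => /predU1P[->|qp]; first by rewrite eqxx.
    by rewrite (ltn_eqF qp) y10.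
  move=> l q; rewrite ltnS leq_eqVlt => qp.
  have qn : q < n by case/predU1P: qp => [->|qp] //; apply: ltn_trans pn.
  have Enp : (ph l + q == n + p) = ~~ (l < k) && (q == p).
    by rewrite /ph; case: (ltnP l k) => _; rewrite ?eqn_add2l //= ?add0n ltn_eqF // ltn_addr.
  have Ep : (ph l + q == p) = (l < k) && (q == p).
    by rewrite /ph; case: (ltnP l k) => _ //=; rewrite gtn_eqF // ltn_addr.
  split=> [|b].
    rewrite z7 Enp Ep [RHS]switch_phase; case/predU1P: qp => [->|qp].
      by rewrite eqxx !andbT; case: (l < k).
    by rewrite (ltn_eqF qp) !andbF; have [-> _] := y7 l q qp; apply: switch_phase.
  transitivity (z (if b then 9 else 8) (ph l + q)); first by case: (b).
  rewrite zb Enp Ep [RHS]target_phase; case/predU1P: qp => [->|qp].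
    by rewrite eqxx !andbT; case: (l < k).
  by rewrite (ltn_eqF qp) !andbF; have [_ ->] := y7 l q qp; apply: target_phase. }
split=> //; split=> //.
- by rewrite A.
- by rewrite A.
- by rewrite A.
- by rewrite A1.
- by rewrite A.
- by move=> l p pn; have [H1 H2] := T7 l p pn; split=> //; [apply: (H2 false) | apply: (H2 true)].
by move=> j jE; have [u [v [w H]]] := mE j jE; exists u, v, w; rewrite !(A 0).
Qed.

End Setup.

(** * Expected running time *)

Section Runtime.
Variable R : realType.
Local Open Scope ring_scope.
Implicit Types (s : config) (T t : nat).

Definition mean (f : bool -> R) : R := (f false + f true) / 2.

Lemma mean_le (f g : bool -> R) : (forall b, f b <= g b) -> mean f <= mean g.
Proof. by move=> H; rewrite /mean ler_pM2r ?invr_gt0 // lerD. Qed.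

Lemma mean_cst (c : R) : mean (fun=> c) = c.
Proof. by rewrite /mean; field. Qed.

Lemma meanD (f g : bool -> R) : mean f + mean g = mean (fun b => f b + g b).
Proof. by rewrite /mean; field. Qed.

Lemma mean_scale (c : R) f : c * mean f = mean (fun b => c * f b).
Proof. by rewrite /mean; field. Qed.

Lemma mean_sum n (f : 'I_n -> bool -> R) :
  \sum_i mean (f i) = mean (fun b => \sum_i f i b).
Proof. by rewrite /mean -mulr_suml big_split. Qed.

(* The expectation of the minimum of T and the running time. *)
Fixpoint truncated_runtime T s : R :=
  if T is T'.+1 then
    if halted s then 0 else 1 + mean (fun b => truncated_runtime T' (step s b))
  else 0.

Fixpoint survival T s : R :=
  if halted s then 0
  else if T is T'.+1 then mean (fun b => survival T' (step s b)) else 1.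

Lemma truncated_runtime_ge0 T s : 0 <= truncated_runtime T s.
Proof.
elim: T s => //= T IH s; case: ifP => // _.
by rewrite addr_ge0 // -[0](mean_cst 0) mean_le.
Qed.

Lemma truncated_runtimeS T s : truncated_runtime T s <= truncated_runtime T.+1 s.
Proof.
elim: T s => [|T IH] s; first exact: truncated_runtime_ge0.
rewrite [leLHS]/= [leRHS]/=; case: ifP => // _.
by rewrite lerD2l; apply: mean_le => b; apply: IH.
Qed.

Lemma truncated_runtime_step T s :
  truncated_runtime T s <= 1 + mean (fun b => truncated_runtime T (step s b)).
Proof.
apply: le_trans (truncated_runtimeS T s) _ => /=; case: ifP => // _.
by rewrite addr_ge0 // -[0](mean_cst 0) mean_le // => b; apply: truncated_runtime_ge0.
Qed.

Lemma truncated_runtime_reaches T s t s' : reaches s t s' ->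
  truncated_runtime T s <= t%:R + truncated_runtime T s'.
Proof.
elim: t s => [|t IH] s Rs; first by rewrite add0r -(Rs [::]).
apply: le_trans (truncated_runtime_step T s) _.
rewrite -natr1 -addrA addrCA lerD2l addrC.
rewrite -[leRHS]mean_cst; apply: mean_le => b; rewrite addrC.
by apply: IH => coins sc; rewrite -(Rs (b :: coins)) //= sc.
Qed.

Lemma halts_exactly_cons s b coins :
  halts_exactly s (b :: coins) = ~~ halted s && halts_exactly (step s b) coins.
Proof.
rewrite /halts_exactly [run s (b :: coins)]/= [size _]/= andbCA; congr (_ && _).
rewrite [iota _ _]/= [all _ _]/=; congr (_ && _).
rewrite -(addn0 1%N) iotaDl all_map; apply: eq_all => t /=.
by rewrite add0n.
Qed.

Lemma prob_runtime0 s : prob_runtime R s 0 = (halted s)%:R.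
Proof.
rewrite /prob_runtime expr0 divr1; congr (_%:R).
have [hs|hs] := boolP (halted s).
  rewrite (_ : [set _ | _] = [set [tuple]]) ?cards1 //.
  by apply/setP=> t; rewrite !inE tuple0 eqxx /halts_exactly /run /= hs.
apply/eqP; rewrite cards_eq0; apply/eqP/setP=> t.
by rewrite !inE tuple0 /halts_exactly /run /= (negbTE hs).
Qed.

Lemma prob_runtimeS s t : prob_runtime R s t.+1 =
  if halted s then 0 else mean (fun b => prob_runtime R (step s b) t).
Proof.
have H : #|[set coins : t.+1.-tuple bool | halts_exactly s coins]| =
   ((~~ halted s) * \sum_b #|[set coins : t.-tuple bool | halts_exactly (step s b) coins]|)%N.
  rewrite -sum1dep_card (reindex (fun z : bool * t.-tuple bool => [tuple of z.1 :: z.2])) /=; last first.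
    exists (fun w : t.+1.-tuple bool => (thead w, [tuple of behead w])).
      by move=> [b w] _; rewrite theadE; congr pair; apply/val_inj.
    by move=> w _; rewrite [RHS]tuple_eta; apply/val_inj.
  under eq_bigl => z do rewrite halts_exactly_cons.
  case: (halted s) => /=; first by rewrite big_pred0.
  rewrite mul1n; under [RHS]eq_bigr => b _ do rewrite -sum1dep_card.
  by rewrite pair_big_dep /=.
rewrite /prob_runtime H; case: (halted s); first by rewrite mul0n mul0r.
rewrite mul1n big_bool natrD /mean exprS invfM; field.
by rewrite expf_neq0 ?pnatr_eq0.
Qed.

Lemma prob_runtime_ge0 s t : 0 <= prob_runtime R s t.
Proof. by rewrite divr_ge0 // exprn_ge0. Qed.

Lemma survival_ge0 T s : 0 <= survival T s.
Proof.
elim: T s => [|T IH] s /=; case: ifP => // _.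
by rewrite -[0](mean_cst 0) mean_le.
Qed.

Lemma prob_runtime_sum T s :
  \sum_(t < T.+1) prob_runtime R s t + survival T s = 1.
Proof.
elim: T s => [|T IH] s.
  by rewrite big_ord1 prob_runtime0 /=; case: ifP; rewrite ?addr0 ?add0r.
rewrite big_ord_recl prob_runtime0 /=.
under eq_bigr => t _ do rewrite prob_runtimeS.
case: ifP => _; first by rewrite big1_eq !addr0.
by rewrite add0r mean_sum meanD /mean !IH; field.
Qed.

(** Splits the truncated expectation by whether the execution halts within [T] steps. *)
Lemma truncated_runtime_sum T s :
  \sum_(t < T.+1) t%:R * prob_runtime R s t + T%:R * survival T s = truncated_runtime T s.
Proof.
elim: T s => [|T IH] s; first by rewrite big_ord1 !mul0r addr0.
rewrite big_ord_recl mul0r add0r /=.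
under eq_bigr => t _ do rewrite prob_runtimeS.
case: ifP => _; first by rewrite big1 ?add0r ?mulr0 // => t _; rewrite mulr0.
have E : forall b, truncated_runtime T (step s b) + 1 =
   \sum_(t < T.+1) t.+1%:R * prob_runtime R (step s b) t + T.+1%:R * survival T (step s b).
  move=> b; rewrite -IH -[X in _ + X = _](prob_runtime_sum T (step s b)) addrACA -big_split /=.
  by congr (_ + _); [apply: eq_bigr => t _|]; rewrite -natr1 mulrDl mul1r.
have -> : 1 + mean (fun b => truncated_runtime T (step s b)) =
  mean (fun b => truncated_runtime T (step s b) + 1) by rewrite /mean; field.
under eq_bigr => t _ do rewrite mean_scale.
by rewrite mean_sum mean_scale meanD /mean !E.
Qed.

(** Truncated times dominate the partial sums of the first summand. They also force halting almost
    surely, so the summand with [+oo] contributes at most 0. *)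
Lemma expected_runtime_le s (c : R) : (forall T, truncated_runtime T s <= c) ->
  (expected_runtime R s <= c%:E)%E.
Proof.
move=> H.
have p0 t : (0 <= (prob_runtime R s t)%:E)%E by rewrite lee_fin prob_runtime_ge0.
have tp0 t : (0 <= (t%:R * prob_runtime R s t)%:E)%E.
  by rewrite lee_fin mulr_ge0 // prob_runtime_ge0.
have Tp T : \sum_(t < T.+1) t%:R * prob_runtime R s t <= c.
  apply: le_trans (H T); rewrite -truncated_runtime_sum lerDl mulr_ge0 // survival_ge0.
  by [].
have E1 : (\sum_(0 <= t <oo) (t%:R * prob_runtime R s t)%:E <= c%:E)%E.
  apply: lime_le; first by apply: is_cvg_nneseries => t _ _; apply: tp0.
  apply: nearW => T; rewrite sumEFin lee_fin big_mkord.
  apply: le_trans (Tp T); rewrite big_ord_recr /= lerDl mulr_ge0 ?prob_runtime_ge0 //.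
have E2 : (1 <= \sum_(0 <= t <oo) (prob_runtime R s t)%:E)%E.
  apply/lee_addgt0Pr => e e0.
  (* Markov's inequality: [T] times the survival probability is at most [c], and T >= c / e. *)
  pose T := (Num.truncn (c / e)).+1.
  have cT : c <= T%:R * e by rewrite -ler_pdivrMr // ltW // truncnS_gt.
  apply: (@le_trans _ _ ((\sum_(t < T.+1) prob_runtime R s t)%:E + e%:E)%E).
    rewrite -EFinD lee_fin -(prob_runtime_sum T s) lerD2l.
    rewrite -(@ler_pM2l _ T%:R) ?ltr0Sn //; apply: le_trans cT.
    apply: le_trans (H T); rewrite -truncated_runtime_sum lerDr sumr_ge0 // => t _.
    by rewrite mulr_ge0 ?prob_runtime_ge0.
  apply: leeD => //; rewrite -sumEFin -(big_mkord xpredT (fun t => (prob_runtime R s t)%:E)).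
  by apply: nneseries_lim_ge => t _ _; apply: p0.
rewrite /expected_runtime -[leRHS]adde0; apply: leeD => //.
by apply: mule_ge0_le0 => //; rewrite sube_le0.
Qed.

(** If no coin sequence led to halting, the second summand would be [+oo]. This turns a time bound
    into an existence proof. *)
Lemma expected_runtime_halts s : (expected_runtime R s < +oo)%E ->
  exists coins, halted (run s coins).
Proof.
apply: contraPP => /forallNP nh.
have p0 t : prob_runtime R s t = 0.
  rewrite /prob_runtime (_ : [set _ | _] = finset.set0) ?cards0 ?mul0r //.
  apply/setP=> w; rewrite !inE /halts_exactly; apply/negbTE/negP=> /andP[h _].
  exact: nh h.
rewrite /expected_runtime.
rewrite (_ : (\sum_(0 <= t <oo) (prob_runtime R s t)%:E)%E = 0%E); last first.
  by apply: eseries0 => t _ _; rewrite p0.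
rewrite eseries0; last by move=> t _ _; rewrite p0 mulr0.
by rewrite sube0 mule1 add0e ltxx.
Qed.

End Runtime.

(** * Numerical estimates *)

Section Constants.
Variable R : realType.
Local Open Scope ring_scope.

(** Equivalent to exp(1/2) <= 2, which follows from exp(-1/2) >= 1 - 1/2. *)
Lemma ln2_ge_half : 2^-1 <= ln 2 :> R.
Proof.
have e2 : expR (2^-1) <= 2 :> R.
  have := expR_ge1Dx (- (2^-1) : R).
  rewrite expRN; have e0 := expR_gt0 (2^-1 : R) => H.
  have : (1 - 2^-1) * expR 2^-1 <= 1 :> R.
    by rewrite -[leRHS](mulVf (lt0r_neq0 e0)) ler_pM2r.
  lra.
rewrite -[leLHS]expRK ler_ln ?posrE ?expR_gt0 ?ltr0n //.
Qed.

(** The square of the hypothesis on [r], with r < 4 * 2^k and [ln d] replaced by its lower bound q /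
    2; a factor 16 clears the denominator of the fourth power. *)
Lemma square_bound (d r k q : nat) : (0 < d)%N -> q%:R / 2 <= ln (d%:R : R) ->
  10 ^+ 7 * Num.sqrt (d%:R : R) * ln (d%:R : R) ^+ 2 < r%:R -> (r < 2 ^ k.+2)%N ->
  (10 ^ 14 * d * q ^ 4 < 256 * 4 ^ k)%N.
Proof.
move=> d0 Hq Hr rk.
have q0 : 0 <= q%:R / 2 :> R by rewrite divr_ge0.
have l0 : 0 <= ln (d%:R : R) by apply: le_trans Hq.
have lhs0 : 0 <= 10 ^+ 7 * Num.sqrt (d%:R : R) * ln (d%:R : R) ^+ 2.
  by rewrite !mulr_ge0 ?sqrtr_ge0 ?exprn_ge0.
have r2 : (10 ^+ 7 * Num.sqrt (d%:R : R) * ln (d%:R : R) ^+ 2) ^+ 2 < r%:R ^+ 2.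
  by rewrite ltr_pXn2r // ?nnegrE // ler0n.
have r3 : r%:R ^+ 2 <= 16 * 4 ^+ k :> R.
  rewrite -!natrX -natrM ler_nat (_ : 16 * 4 ^ k = (2 ^ k.+2) ^ 2)%N; first by rewrite leq_exp2r // ltnW.
  by rewrite !expnS expn0 (_ : 4 ^ k = 2 ^ k * 2 ^ k)%N; [ring | rewrite -expnMn].
rewrite exprMn [(_ * Num.sqrt _) ^+ 2]exprMn sqr_sqrtr ?ler0n // in r2.
have q4 : (q%:R / 2) ^+ 4 <= (ln (d%:R : R) ^+ 2) ^+ 2.
  by rewrite -exprM ler_pXn2r // nnegrE.
have E1 : (10 ^ 14 * d * q ^ 4)%:R = 10 ^+ 14 * d%:R * q%:R ^+ 4 :> R by rewrite 2!natrM 2!natrX.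
have E2 : (256 * 4 ^ k)%:R = 256 * 4 ^+ k :> R by rewrite natrM natrX.
rewrite -(ltr_nat R) E1 E2.
have d0' : 0 < d%:R :> R by rewrite ltr0n.
have H1 : (10 ^+ 7) ^+ 2 * d%:R * (q%:R / 2) ^+ 4 < 16 * 4 ^+ k :> R.
  apply: le_lt_trans (lt_le_trans r2 r3).
by rewrite ler_wpM2l // mulr_ge0 ?exprn_ge0 // ler0n.
rewrite -exprM in H1.
have -> : 10 ^+ 14 * d%:R * q%:R ^+ 4 = 16 * (10 ^+ (7 * 2) * d%:R * (q%:R / 2) ^+ 4) :> R.
  by rewrite [(7 * 2)%N]/=; field.
by move: H1; set X := (_ * _ * _ ^+ 4); set Y := 4 ^+ k; lra.
Qed.

(** For d < 2^k the claim reduces to 384 k <= 2^k, which holds from k = 13 on. For d >= 2^k one has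
    ln d >= k / 2, and the fourth power of the logarithm in the squared hypothesis pays for the
    factor k. *)
Lemma exponent_exists (d r : nat) : (2 <= d)%N ->
  10 ^+ 7 * Num.sqrt (d%:R : R) * ln (d%:R : R) ^+ 2 < r%:R ->
  exists k, [/\ (0 < k)%N, (2 ^ k.+1 <= r)%N, (r < 2 ^ k.+2)%N & (384 * d * k <= 4 ^ k)%N].
Proof.
move=> d2 Hr.
have d0 : (0 < d)%N by apply: leq_trans d2.
have lnd (q : nat) : (2 ^ q <= d)%N -> q%:R / 2 <= ln (d%:R : R).
  move=> qd; apply: (@le_trans _ _ (ln (2 ^+ q : R))).
    by rewrite lnXn ?ltr0n // -[leRHS]mulr_natl ler_wpM2l // ln2_ge_half.
  by rewrite ler_ln ?posrE ?exprn_gt0 ?ltr0n // -natrX ler_nat.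
have r0 : (0 < r)%N.
  rewrite -(ltr_nat R); apply: le_lt_trans Hr.
  by rewrite !mulr_ge0 ?sqrtr_ge0 ?exprn_ge0 // (le_trans _ (lnd 0%N _)) ?mul0r.
set t := trunc_log 2 r.
have tr : (2 ^ t <= r)%N by apply: trunc_logP.
have rt : (r < 2 ^ t.+1)%N by apply: trunc_log_ltn.
(* Already d >= 2 forces r >= 2^14, because 2 * 10^14 > 256 * 4^12. *)
have t14 : (13 < t)%N.
  rewrite ltnNge; apply/negP=> t13.
  have rt' : (r < 2 ^ 12.+2)%N by apply: leq_trans rt _; rewrite leq_exp2l.
  have := square_bound d0 (lnd 1%N d2) Hr rt'.
  rewrite exp1n muln1 => H.
  lia.
have Et : t.-1.+1 = t by rewrite prednK // (ltn_trans _ t14).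
exists t.-1; rewrite Et; split=> //; first by rewrite -ltnS Et (ltn_trans _ t14).
set k := t.-1.
have k13 : (12 < k)%N by rewrite -ltnS Et.
have rk : (r < 2 ^ k.+2)%N by rewrite /k Et.
have [dk|kd] := ltnP d (2 ^ k).
  have k384 : forall m, (384 * (13 + m) <= 2 ^ (13 + m))%N.
    by elim=> [|m IH] //; rewrite addnS expnS; move: IH; lia.
  have := k384 (k - 13)%N; rewrite subnKC // => H.
  rewrite (_ : 4 ^ k = 2 ^ k * 2 ^ k)%N; last by rewrite -expnMn.
  by rewrite mulnAC leq_mul // ltnW.
have H := square_bound d0 (lnd k kd) Hr rk.
rewrite -(leq_pmul2l (_ : 0 < 256)%N) //; apply: leq_trans (ltnW H).
have : (1 <= k ^ 3)%N by rewrite expn_gt0 (ltn_trans _ k13).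
rewrite [(k ^ 4)%N]expnSr; move: (k ^ 3)%N => c c1.
apply: (@leq_trans (10 ^ 14 * (d * k))%N).
  by rewrite -(mulnA 384); move: (d * k)%N => z; lia.
by rewrite -mulnA leq_mul2l leq_mul2l leq_pmull ?orbT.
Qed.

Lemma bernoulli_ge (x : R) n : 0 <= x <= 1 -> 1 - n%:R * x <= (1 - x) ^+ n.
Proof.
move=> /andP[x0 x1]; elim: n => [|n IH]; first by rewrite mul0r subr0 expr0.
rewrite exprS; apply: (@le_trans _ _ ((1 - x) * (1 - n%:R * x))); last first.
  by rewrite ler_wpM2l // subr_ge0.
have : 0 <= n%:R * x * x by rewrite !mulr_ge0.
rewrite -natr1; set z := n%:R; nra.
Qed.

(** The weight [y] is far enough below 2 to allow lam < 2, yet so close that Bernoulli's inequality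
    gives y^(6k) >= 64^k / 2. With lam - y = 1 / (12 k) and y <= 2 it remains to see 16 d 16^k <=
    64^k / (24 k), which is 384 d k <= 4^k. *)
Lemma growth_rate (d k : nat) (x := (12 * k%:R)^-1 : R) : (0 < k)%N ->
  (384 * d * k <= 4 ^ k)%N ->
  let y := 2 * (1 - x) in let lam := 2 * (1 - x / 2) in
  1 <= y /\ (8 * d * 16 ^ k)%:R * y <= (lam - y) * y ^+ (3 * (k + k)).
Proof.
move=> k0 H y lam.
have k1 : 1 <= k%:R :> R by rewrite ler1n.
have kx : k%:R * x = 12^-1 by rewrite /x; field; rewrite pnatr_eq0 -lt0n.
have x0 : 0 < x by rewrite invr_gt0; nra.
have x12 : x <= 12^-1 by rewrite -kx ler_peMl // ltW.
have x1 : 0 <= x <= 1 by rewrite ltW //=; lra.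
split; first by rewrite /y; lra.
have -> : lam - y = x by rewrite /lam /y; field.
have B : 2^-1 <= (1 - x) ^+ (3 * (k + k)).
  apply: le_trans (bernoulli_ge _ x1).
  have -> : (3 * (k + k))%:R = 6 * k%:R :> R by rewrite natrM natrD; ring.
  by rewrite -mulrA kx; lra.
have -> : y ^+ (3 * (k + k)) = 64 ^+ k * (1 - x) ^+ (3 * (k + k)).
  rewrite /y exprMn; congr (_ * _).
  rewrite (_ : (3 * (k + k)) = 6 * k)%N; last by rewrite addnn -mul2n mulnA.
  by rewrite exprM; congr (_ ^+ k); rewrite -natrX.
apply: (@le_trans _ _ (x * (64 ^+ k * 2^-1))); last first.
  by rewrite ler_wpM2l ?(ltW x0) // ler_wpM2l ?exprn_ge0.
apply: (@le_trans _ _ ((8 * d * 16 ^ k)%:R * 2)).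
  by rewrite ler_wpM2l // /y; lra.
have -> : x * (64 ^+ k * 2^-1) = 64 ^+ k / (24 * k%:R).
  by rewrite /x; field; rewrite pnatr_eq0 -lt0n.
rewrite ler_pdivlMr; last by nra.
rewrite -natrX -!natrM ler_nat.
rewrite (_ : 64 ^ k = 16 ^ k * 4 ^ k)%N; last by rewrite -expnMn.
apply: leq_trans (_ : 16 ^ k * (384 * d * k) <= _)%N; last by rewrite leq_mul2l H orbT.
by rewrite [leqLHS](_ : _ = 16 ^ k * (384 * d * k))%N //; ring.
Qed.

(** The first 2 C A terms count at most 1 each. By then q^(2 C A) <= 4^-C has absorbed 3^C, and the
    remaining geometric series sums to at most [A]. *)
Lemma geometric_tail (u : nat -> R) (C A : nat) (q : R) : (0 < A)%N ->
  q = 1 - (A%:R)^-1 -> (forall j, 0 <= u j <= 1) ->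
  (forall j, u j <= 3 ^+ C * q ^+ j) ->
  forall T, \sum_(j < T) u j <= (2 * C * A + A)%:R.
Proof.
move=> A0 Eq u01 uq T.
have A1 : 1 <= A%:R :> R by rewrite ler1n.
have /andP[Ainv0 Ainv1] : 0 < (A%:R^-1 : R) <= 1 by rewrite invr_gt0 invf_le1 ?(lt_le_trans _ A1) // ltr01.
have q0 : 0 <= q by rewrite Eq; lra.
have q1 : q < 1 by rewrite Eq; lra.
(* From (1 - 1/A)^A (1 + 1/A)^A <= 1 and (1 + 1/A)^A >= 2. *)
have half_ : q ^+ A <= 2^-1.
  have H1 : q ^+ A * (1 + A%:R^-1) ^+ A <= 1.
    rewrite -exprMn exprn_ile1 // Eq; nra.
  have H2 : 2 <= (1 + A%:R^-1) ^+ A :> R.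
    have : forall m, 1 + m%:R * A%:R^-1 <= (1 + A%:R^-1) ^+ m :> R.
      elim=> [|m IH]; first by rewrite mul0r addr0 expr0.
      rewrite exprS -natr1; have : 0 <= m%:R * A%:R^-1 * A%:R^-1 :> R by rewrite !mulr_ge0 //; lra.
      set z := m%:R in IH *; nra.
    by move=> /(_ A); rewrite divff ?pnatr_eq0 -?lt0n // => H; exact: H.
  have qA0 : 0 <= q ^+ A by rewrite exprn_ge0.
  nra.
have uJ i : u (2 * C * A + i)%N <= q ^+ i.
  apply: le_trans (uq _) _; rewrite exprD mulrA ler_piMl ?exprn_ge0 //.
  rewrite [(2 * C * A)%N](_ : _ = A * 2 * C)%N; last by ring.
  rewrite exprM -exprMn exprn_ile1 ?mulr_ge0 ?exprn_ge0 // exprM.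
  have : q ^+ A * q ^+ A <= 4^-1.
    have := exprn_ge0 A q0; move: (q ^+ A) half_ => z; nra.
  rewrite -expr2; lra.
apply: (@le_trans _ _ (\sum_(j < 2 * C * A + T) u j)).
  rewrite -!(big_mkord xpredT u) (@big_cat_nat _ _ _ T 0 (2 * C * A + T)) ?leq_addl //=.
  by rewrite lerDl sumr_ge0 // => i _; case/andP: (u01 i).
rewrite big_split_ord /= natrD; apply: lerD.
  apply: (@le_trans _ _ (\sum_(i < 2 * C * A) 1)).
    by apply: ler_sum => i _; case/andP: (u01 i).
  by rewrite sumr_const card_ord.
apply: (@le_trans _ _ (\sum_(i < T) q ^+ i)); first by apply: ler_sum => i _; apply: uJ.
have G : (1 - q) * \sum_(i < T) q ^+ i = 1 - q ^+ T by rewrite -[1 - q]opprB -[1 - q ^+ T]opprB mulNr subrX1.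
have q1' : 0 < 1 - q by lra.
have qA : (1 - q) * A%:R = 1 by rewrite Eq; field; rewrite pnatr_eq0 -lt0n.
by rewrite -(ler_pM2l q1') G qA gerBl exprn_ge0.
Qed.

End Constants.

(** * The coloring algorithm *)

Lemma unfinished_le (X : finType) select choice j (s : assignment X) :
  unfinished select choice j s <= 2 ^ j.
Proof.
elim: j s => [|j IH] s /=; case: ifP => // _.
by rewrite expnS mul2n -addnn leq_add.
Qed.

Lemma card_assignment (X : finType) : #|{: assignment X}| = 3 ^ #|X|.
Proof. by rewrite card_ffun card_option card_bool. Qed.

Definition loop : cmd := While (getc 13) (Seq (Flip 12 (Const 0)) (compile search_prog)).

Definition identity_prog : prog := PFor 21 0 (PPut 1 (getc 21) (getc 21)).

(* With at most r vertices each vertex gets its own color. *)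
Definition coloring_algorithm : cmd :=
  If (Get 0 (Const 1) :+ Const 1 :- getc 0) (compile identity_prog)
    (Seq (compile size_prog) (Seq (compile table_prog) (Seq (compile select_prog)
      (Seq loop (compile color_prog))))).

Lemma nth_flatten3 (L : seq (seq nat)) j i : all (fun l => size l == 3) L -> j < size L -> i < 3 ->
  nth 0 (flatten L) (3 * j + i) = nth 0 (nth [::] L j) i.
Proof.
elim: L j => // l L IH [|j] /= /andP[/eqP sl sL] jL i3; rewrite nth_cat sl.
  by rewrite muln0 add0n i3.
rewrite ifF; last by apply/negbTE; rewrite -leqNgt mulnS -addnA leq_addr.
by rewrite mulnS -addnA addKn IH.
Qed.

Lemma size3 (T : Type) (l : seq T) : size l = 3 -> exists u v w, l = [:: u; v; w].
Proof. by case: l => [|u [|v [|w []]]] // _; exists u, v, w. Qed.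

Lemma encode_edges n (E : {set {set 'I_n}}) r j : (forall e, e \in E -> #|e| = 3) -> j < #|E| ->
  exists u v w : 'I_n, [/\ enum (nth finset.set0 (enum E) j) = [:: u; v; w],
    nth 0 (encode E r) (3 + 3 * j) = u, nth 0 (encode E r) (4 + 3 * j) = v &
    nth 0 (encode E r) (5 + 3 * j) = w].
Proof.
move=> E3 jE; have jE' := jE; rewrite cardE in jE'.
set e := nth _ _ j.
have eE : e \in E by rewrite -mem_enum mem_nth.
have [u [v [w Ee]]] : exists u v w, enum e = [:: u; v; w] by apply: size3; rewrite -cardE E3.
exists u, v, w.
have H i : i < 3 -> nth 0 (encode E r) (3 + (3 * j + i)) = nth 0 [:: val u; val v; val w] i.
  move=> i3; rewrite /encode [nth _ _ _]/= nth_flatten3 ?size_map //.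
    by rewrite (nth_map finset.set0) // -/e Ee.
  by apply/allP=> _ /mapP[e' e'E ->]; rewrite size_map -cardE E3 // -mem_enum.
split=> //.
- by have := H 0 isT; rewrite addn0.
- by have := H 1 isT; rewrite [RHS]/= => <-; congr nth; lia.
by have := H 2 isT; rewrite [RHS]/= => <-; congr nth; lia.
Qed.

Lemma card_edges_le n (E : {set {set 'I_n}}) : (forall e, e \in E -> #|e| = 3) -> #|E| <= n ^ 3.
Proof.
move=> E3; apply: (@leq_trans 'C(n, 3)).
  rewrite -[n in 'C(n, _)]card_ord -card_draws; apply/subset_leq_card/subsetP=> e eE.
  by rewrite inE E3.
rewrite -[leqLHS]muln1; apply: (@leq_trans ('C(n, 3) * 3`!)).
  by rewrite leq_mul2l fact_gt0 orbT.
rewrite bin_ffact; elim: 3 => // m IH.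
by rewrite ffactnSr expnSr leq_mul // leq_subr.
Qed.

(** * Correctness and expected time of the main loop *)

Section Coloring.
Variables (R : realType) (n r k d : nat) (E : {set {set 'I_n}}).
Hypothesis k0 : 0 < k.
Hypothesis rn : r < n.
Hypothesis kr : 2 ^ k.+1 <= r.
Hypothesis rk : r < 2 ^ k.+2.
Hypothesis dk : 384 * d * k <= 4 ^ k.
Hypothesis E3 : forall e, e \in E -> #|e| = 3.
Hypothesis Ed : forall v, #|[set e in E | v \in e]| <= d.

Let kn : 2 ^ k <= n.
Proof.
by apply: leq_trans (ltnW rn); apply: leq_trans kr; rewrite leq_exp2l.
Qed.

Notation K := (k + k).
Notation M := (K * n).
Notation state := (assignment 'I_M).
Local Notation unfin := (unfinished (last_unassigned k0 kn) (bad_choice r E)).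
Implicit Types (s : state) (m : memory).

(** The [j]-th term is the probability that the search needs more than [j] coins, so the sum bounds
    the expected number of rounds. *)
Lemma unfinished_total T :
  (\sum_(j < T) (unfin j (empty_assignment _))%:R / 2 ^+ j <= (2 * M * (24 * k) + 24 * k)%:R :> R)%R.
Proof.
pose u (j : nat) : R := ((unfin j (empty_assignment _))%:R / 2 ^+ j)%R.
have k1 : (1 <= k%:R :> R)%R by rewrite ler1n.
apply: (@geometric_tail R u M (24 * k) _ _ erefl); first by rewrite muln_gt0.
  move=> j; rewrite divr_ge0 ?exprn_ge0 //= ler_pdivrMr ?exprn_gt0 // mul1r.
  by rewrite -natrX ler_nat unfinished_le.
move=> j; have [y1 gr] := growth_rate R k0 dk.
have := unfinished_bound (last_unassignedP k0 kn) (@bad_choice_some n r k E) (bad_choice_none k0 kn)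
  (bad_pattern_size k0 kn kr E3) (patterns_through_cell k0 kn kr E3 Ed) y1 gr j (empty_pattern_free k0 kn kr E3).
rewrite card_assignment card_ord natrX => H.
rewrite /u ler_pdivrMr ?exprn_gt0 //; apply: le_trans H _.
rewrite -mulrA ler_wpM2l ?exprn_ge0 // -exprMn.
rewrite (_ : (1 - (24 * k)%:R^-1) * 2 = 2 * (1 - (12 * k%:R)^-1 / 2) :> R)%R //.
by rewrite natrM; field; lra.
Qed.

Definition head m : config := ([:: loop; compile color_prog], m).

Definition loop_invariant m s :=
  [/\ static r k E m, represents m s, m 13 0 = selection s &
      pattern_free (bad_patterns r k E) s].

Definition finished (c : config) :=
  exists f : 'I_n -> 'I_r, equitable_coloring E f /\ outputs c f.

Definition env (b : nat) : nat :=
  if b == 5 then K else if b == 6 then M else if b == 26 then #|E| else n.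

Lemma static_reaches p ks m : static r k E m -> well_formed p ->
  all (mem [:: 0; 5; 6; 26]) (bounds p) ->
  exists2 t, t <= time_bound p env & reaches (compile p :: ks, m) t (ks, den p m).
Proof.
move=> sm /andP[cs /allP W] /allP S; apply: reaches_compile => // b /S.
rewrite !inE => /or4P[] /eqP ->; [exact: static_n sm|exact: static_K sm|exact: static_M sm|exact: static_E sm].
Qed.

Lemma loop_turn m s (b : bool) : loop_invariant m s -> ~~ complete_assignment s ->
  exists m', loop_invariant m' (search (last_unassigned k0 kn) (bad_choice r E) s b) /\
    exists2 t, t <= time_bound search_prog env &
    reaches ([:: compile search_prog; loop; compile color_prog], update m 12 0 b) t (head m').
Proof.
move=> [sm rm m13 pf] ncs.
set m1 := update m 12 0 b.
have A1 : agree [:: 12] m m1 by apply: agree_update.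
have sm1 : static r k E m1 by apply: static_agree A1 _ sm.
have [s2 r2 m2] : [/\ static r k E (den search_prog m1),
   represents (den search_prog m1) (search (last_unassigned k0 kn) (bad_choice r E) s b) &
   den search_prog m1 13 0 = selection (search (last_unassigned k0 kn) (bad_choice r E) s b)].
  by apply: search_spec.
exists (den search_prog m1); split.
  split=> //; apply: search_pattern_free => //.
  - exact: bad_choice_some.
  exact: bad_choice_none.
exact: static_reaches.
Qed.

Lemma loop_exit m s : loop_invariant m s -> complete_assignment s ->
  finished ([::], den color_prog m) /\
  exists2 t, t <= time_bound color_prog env &
    reaches ([:: compile color_prog], m) t ([::], den color_prog m).
Proof.
move=> [sm rm m13 pf] cs; split; last first.
  exact: static_reaches.
have [cm _ _] := color_spec k0 kn sm rm.
have [f [fc [fp fe]]] := complete_coloring k0 kn kr (pattern_free_not_bad pf) cs.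
exists f; split; last by move=> v; rewrite fc; have [] := cm v (ltn_ord v).
split=> [e eE|c]; first exact: fp.
rewrite fe card_ord; case: ltnP => H; [right | by left; rewrite addn0].
by rewrite /dvdn -lt0n (leq_ltn_trans _ H).
Qed.

(** Every turn of the loop uses up coins, hence strong induction on their number. *)
Lemma loop_safe N m s : loop_invariant m s -> safe finished N (head m).
Proof.
elim/ltn_ind: N m s => N IH m s inv; have [sm rm m13 pf] := inv.
apply: safe_running => // N' b NE.
have [cs|ncs] := boolP (complete_assignment s).
  have -> : step (head m) b = ([:: compile color_prog], m).
    by rewrite /= m13 (selectionE k0 kn) cs.
  have [fin [t _ Rt]] := loop_exit inv cs.
  by apply: safe_reaches Rt _; apply: safe_halted.
have -> : step (head m) b =
    ([:: Seq (Flip 12 (Const 0)) (compile search_prog); loop; compile color_prog], m).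
  by rewrite /= m13 (selectionE k0 kn) (negbTE ncs).
apply: (@safe_reaches _ _ _ 1 ([:: Flip 12 (Const 0); compile search_prog; loop; compile color_prog], m)).
  exact: reaches_step.
apply: safe_running => // N'' c NE'.
have [m' [inv' [t _ Rt]]] := loop_turn c inv ncs.
apply: safe_reaches Rt _; apply: IH inv'.
by rewrite NE NE'.
Qed.

(** The term for j = 0 pays for the present round; the others are the mean over its coin of the sum
    for the next state. The 3 extra steps of a round are the test, the unfolding of [Seq] and the
    flip. *)
Lemma loop_runtime T m s : loop_invariant m s ->
  (truncated_runtime R T (head m) <= (time_bound color_prog env).+1%:R +
    (time_bound search_prog env).+3%:R * \sum_(j < T) (unfin j s)%:R / 2 ^+ j)%R.
Proof.
elim: T m s => [|T IH] m s inv.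
  by rewrite big_ord0 mulr0 addr0.
have [sm rm m13 pf] := inv.
have S0 : (0 <= \sum_(j < T.+1) (unfin j s)%:R / 2 ^+ j :> R)%R.
  by apply: sumr_ge0 => j _; rewrite divr_ge0 ?exprn_ge0.
have [cs|ncs] := boolP (complete_assignment s).
  apply: (@le_trans _ _ (time_bound color_prog env).+1%:R%R); last by rewrite lerDl mulr_ge0.
  have -> : truncated_runtime R T.+1 (head m) = (1 + truncated_runtime R T ([:: compile color_prog], m))%R.
    by rewrite /= m13 (selectionE k0 kn) cs /= mean_cst.
  have [fin [t tb Rt]] := loop_exit inv cs.
  rewrite -natr1 addrC lerD2r; apply: le_trans (truncated_runtime_reaches R T Rt) _.
  rewrite (_ : truncated_runtime R T ([::], _) = 0%R) ?addr0 ?ler_nat //.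
  by case: (T).
set s1 := ([:: Seq (Flip 12 (Const 0)) (compile search_prog); loop; compile color_prog], m).
have -> : truncated_runtime R T.+1 (head m) = (1 + truncated_runtime R T s1)%R.
  by rewrite /= m13 (selectionE k0 kn) (negbTE ncs) /= mean_cst.
set s2 := ([:: Flip 12 (Const 0); compile search_prog; loop; compile color_prog], m).
have R1 : reaches s1 1 s2 by apply: reaches_step.
have R2 := truncated_runtime_step R T s2.
set B := time_bound search_prog env; set C := time_bound color_prog env.
have R3 b : (truncated_runtime R T (step s2 b) <= B%:R + (C.+1%:R +
   B.+3%:R * \sum_(j < T) (unfin j (search (last_unassigned k0 kn) (bad_choice r E) s b))%:R / 2 ^+ j))%R.
  have [m' [inv' [t tb Rt]]] := loop_turn b inv ncs.
  apply: le_trans (truncated_runtime_reaches R T Rt) _.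
  by apply: lerD; [rewrite ler_nat | apply: IH].
have {}R1 := truncated_runtime_reaches R T R1.
have {}R3 := mean_le R3.
clearbody B C.
have -> : (\sum_(j < T.+1) (unfin j s)%:R / 2 ^+ j = 1 + mean (fun b : bool =>
    \sum_(j < T) (unfin j (search (last_unassigned k0 kn) (bad_choice r E) s b))%:R / 2 ^+ j) :> R)%R.
  rewrite big_ord_recl /= (negbTE ncs) expr0 divr1; congr (_ + _)%R.
  rewrite -mean_sum; apply: eq_bigr => j _; rewrite /= ?(negbTE ncs) /mean natrD exprS.
  by field; rewrite expf_neq0 ?pnatr_eq0.
move: R3; rewrite -!meanD !mean_cst -mean_scale => R3.
apply: le_trans (lerD (lexx 1%R) (le_trans R1 (lerD (lexx 1%:R%R) (le_trans R2 (lerD (lexx 1%R) R3))))) _.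
rewrite -[B.+3]addn3 natrD; set X := mean _; rewrite [leRHS]addrC mulrDr mulr1; move: (_ * X)%R => Y; lra.
Qed.

End Coloring.

Lemma time_bound_mono p e1 e2 : (forall b, e1 b <= e2 b) -> time_bound p e1 <= time_bound p e2.
Proof.
move=> H; elim: p => //= [p IHp q IHq|_ p IHp q IHq|_ b p IHp].
- by rewrite ltnS leq_add.
- by rewrite ltnS leq_add.
by rewrite leq_add2r leq_mul // leq_add2r.
Qed.

Definition cubic_env (x b : nat) : nat :=
  if b == 5 then 2 * x else if b == 6 then 2 * x * x else if b == 26 then x * x * x else x.

Lemma time_bound_cubic x : 0 < x ->
  [/\ time_bound search_prog (cubic_env x) <= 500 * (x * x * x),
      time_bound color_prog (cubic_env x) <= 200 * (x * x * x),
      time_bound size_prog (cubic_env x) <= 50 * (x * x * x),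
      time_bound table_prog (cubic_env x) <= 200 * (x * x * x) &
      time_bound select_prog (cubic_env x) <= 50 * (x * x * x)].
Proof.
move=> x0.
have x1 : 1 <= x * x * x by rewrite !muln_gt0 x0.
have x2 : x <= x * x * x by rewrite -mulnA leq_pmulr // muln_gt0 x0.
have x3 : x * x <= x * x * x by rewrite leq_pmulr.
by split; rewrite /= /cubic_env /=; lia.
Qed.

(** * The whole algorithm for more than [r] vertices *)

Section Algorithm.
Variables (R : realType) (n r k d : nat) (E : {set {set 'I_n}}).
Hypothesis k0 : 0 < k.
Hypothesis rn : r < n.
Hypothesis kr : 2 ^ k.+1 <= r.
Hypothesis rk : r < 2 ^ k.+2.
Hypothesis dk : 384 * d * k <= 4 ^ k.
Hypothesis E3 : forall e, e \in E -> #|e| = 3.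
Hypothesis Ed : forall v, #|[set e in E | v \in e]| <= d.

Let kn : 2 ^ k <= n.
Proof.
by apply: leq_trans (ltnW rn); apply: leq_trans kr; rewrite leq_exp2l.
Qed.

Notation K := (k + k).
Notation M := (K * n).
Local Notation envE := (env k E).

Lemma env_cubic b : envE b <= cubic_env n.+1 b.
Proof.
have kn' : k <= n by apply: leq_trans kn; apply/ltnW/ltn_expl.
rewrite /env /cubic_env; do 3?case: ifP => _ //; first by lia.
- by rewrite leq_mul //; lia.
by apply: leq_trans (card_edges_le E3) _; rewrite !expnS expn0 muln1 mulnA !leq_mul.
Qed.

Definition startup_time := time_bound size_prog envE + time_bound table_prog envE +
  time_bound select_prog envE + 5.

Lemma startup : exists m, loop_invariant r E m (empty_assignment 'I_M) /\
  exists2 t, t <= startup_time &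
    reaches (initial coloring_algorithm (encode E r)) t (head m).
Proof.
set m0 := (initial coloring_algorithm (encode E r)).2.
have m0n : m0 0 0 = n by [].
have m0r : m0 0 1 = r by [].
have [m12 m13 m14 m15 [m126 A1]] := size_spec k0 kn kr rk m0n m0r.
have [b|b|t1 tb1 R1] := @reaches_compile size_prog envE
   [:: Seq (compile table_prog) (Seq (compile select_prog) (Seq loop (compile color_prog)))] m0 isT.
- by rewrite !inE => /eqP ->.
- by rewrite !inE => /eqP ->.
move: (den size_prog m0) m12 m13 m14 m15 m126 A1 R1 => m1 m12 m13 m14 m15 m126 A1 R1.
have m1n : m1 0 0 = n by rewrite A1.
have m1r : m1 0 1 = r by rewrite A1.
have m1E : m1 26 0 = #|E| by rewrite m126.
have m1e j : j < #|E| -> exists u v w : 'I_n,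
    [/\ enum (nth finset.set0 (enum E) j) = [:: u; v; w], m1 0 (3 + 3 * j) = u,
        m1 0 (4 + 3 * j) = v & m1 0 (5 + 3 * j) = w].
  by move=> jE; have [u [v [w H]]] := encode_edges r E3 jE; exists u, v, w; rewrite !(A1 0).
have [sm A2] := table_spec k0 kn kr rk m1n m1r m12 m13 m14 m15 m1E m1e.
have [b|b|t2 tb2 R2] := @reaches_compile table_prog envE
   [:: Seq (compile select_prog) (Seq loop (compile color_prog))] m1 isT.
- by rewrite !inE => /orP[] /eqP ->.
- by rewrite !inE => /orP[] /eqP -> //; rewrite A1.
move: (den table_prog m1) sm A2 R2 => m2 sm A2 R2.
have rm2 : represents m2 (empty_assignment 'I_M).
  by move=> i iM; rewrite A2 // A1 // /lookup; case: insubP => // x _ _; rewrite ffunE.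
have [m313 A3] := select_spec sm rm2.
have [//|//|t3 tb3 R3] := static_reaches [:: Seq loop (compile color_prog)] sm (_ : well_formed select_prog).
move: (den select_prog m2) m313 A3 R3 => m3 m313 A3 R3.
exists m3; split.
  split=> //.
  - by apply: static_agree A3 _ sm.
  - by move=> i iM; rewrite A3 //; apply: rm2.
  exact: empty_pattern_free.
exists (1 + (1 + (t1 + (1 + (t2 + (1 + (t3 + 1))))))).
  by rewrite /startup_time; clear dk; lia.
apply: (@reaches_trans _ ([:: Seq (compile size_prog) (Seq (compile table_prog) (Seq (compile select_prog)
      (Seq loop (compile color_prog))))], m0)).
  apply: reaches_step => _ /=; rewrite -/m0 ifF //; apply/negbTE; rewrite negbK subn_eq0 addn1.
  exact: rn.
apply: reaches_trans (reaches_trans R1 _); first exact: reaches_step.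
apply: reaches_trans (reaches_trans R2 _); first exact: reaches_step.
apply: reaches_trans (reaches_trans R3 _); first exact: reaches_step.
exact: reaches_step.
Qed.

Lemma algorithm_safe N : safe (finished r E) N (initial coloring_algorithm (encode E r)).
Proof.
have [m [inv [t _ Rt]]] := startup.
apply: safe_reaches Rt _; exact: (loop_safe k0 rn kr inv).
Qed.

(** With x = n + 1, at most 120 x^3 expected rounds of at most 503 x^3 steps; the margin up to 250 *
    250 takes in the startup and the final coloring. *)
Lemma algorithm_runtime T : (truncated_runtime R T (initial coloring_algorithm (encode E r)) <=
  (250 * 250 * n.+1 ^ 6)%:R)%R.
Proof.
have [m [inv [t tb Rt]]] := startup.
apply: le_trans (truncated_runtime_reaches R T Rt) _.
apply: le_trans (lerD (lexx _) (loop_runtime R k0 rn kr T inv)) _.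
have U := unfinished_total R k0 rn kr dk E3 Ed T.
apply: le_trans (lerD (lexx _) (lerD (lexx _) (ler_wpM2l (ler0n _ _) U))) _.
rewrite -natrM -!natrD ler_nat.
have [] := time_bound_cubic (ltn0Sn n).
have x1 : 1 <= n.+1 * n.+1 * n.+1 by rewrite !muln_gt0.
have kn' : k <= n.+1 by apply: leqW; apply: leq_trans kn; apply/ltnW/ltn_expl.
have sum3 : 2 * M * (24 * k) + 24 * k <= 120 * (n.+1 * n.+1 * n.+1).
  have H1 : M * k <= (n.+1 + n.+1) * n.+1 * n.+1 by rewrite !leq_mul // leq_add.
  have H2 : k <= n.+1 * n.+1 * n.+1 by apply: leq_trans kn' _; rewrite -mulnA leq_pmulr.
  lia.
have -> : n.+1 ^ 6 = n.+1 * n.+1 * n.+1 * (n.+1 * n.+1 * n.+1).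
  by rewrite !expnS expn0; ring.
have mono p := time_bound_mono p env_cubic.
move: (mono search_prog) (mono color_prog) (mono size_prog) (mono table_prog) (mono select_prog).
move: tb; rewrite /startup_time.
move: (n.+1 * n.+1 * n.+1) x1 sum3 => X X1 sum3.
move: (time_bound search_prog envE) (time_bound color_prog envE) (time_bound size_prog envE)
  (time_bound table_prog envE) (time_bound select_prog envE) => b1 b2 b3 b4 b5.
move: (2 * M * _ + _) sum3 => S sum3 tb h1 h2 h3 h4 h5 g1 g2 g3 g4 g5.
have H : b1.+3 * S <= (503 * X) * (120 * X) by apply: leq_mul => //; lia.
have XX : X <= X * X by rewrite leq_pmulr.
have : 503 * X * (120 * X) = 60360 * (X * X) by ring.
lia.
Qed.

End Algorithm.

(** * The case of at most [r] vertices *)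

Lemma identity_coloring n r (E : {set {set 'I_n}}) (nr : n <= r) : (forall e, e \in E -> #|e| = 3) ->
  equitable_coloring E (widen_ord nr).
Proof.
move=> E3.
have winj : injective (widen_ord nr) by move=> u w /(congr1 val) /= /val_inj.
split.
  move=> e eE [c Hc]; have := E3 e eE.
  have [-> |[u ue]] := set_0Vmem e; first by rewrite cards0.
  rewrite (_ : e = [set u]%SET) ?cards1 //.
  apply/setP=> w; rewrite inE; apply/idP/eqP => [we|-> //].
  by apply: winj; rewrite (Hc u ue) (Hc w we).
move=> c; rewrite card_ord.
have r0 : 0 < r by apply: leq_ltn_trans (ltn_ord c).
have -> : #|[set v | widen_ord nr v == c]| = (c < n).
  case: ltnP => cn.
    rewrite (_ : [set v | _] = [set Ordinal cn]%SET) ?cards1 //.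
    by apply/setP=> v; rewrite !inE -!(inj_eq val_inj).
  apply/eqP; rewrite cards_eq0; apply/eqP/setP=> v; rewrite !inE -(inj_eq val_inj) /=.
  by rewrite ltn_eqF // (leq_trans (ltn_ord v)).
move: (nr); rewrite leq_eqVlt => /predU1P[En|lt].
  by left; rewrite En ltn_ord divnn r0.
rewrite divn_small // add0n /dvdn modn_small //.
case: ltnP => cn; last by left.
by right; rewrite (gtn_eqF (leq_ltn_trans _ cn)).
Qed.

Section FewVertices.
Variables (R : realType) (n r : nat) (E : {set {set 'I_n}}).
Hypothesis nr : n <= r.
Hypothesis E3 : forall e, e \in E -> #|e| = 3.

Lemma identity_run : exists m,
  [/\ forall v, v < n -> m 1 v = v & exists2 t, t <= 7 * n + 4 &
    reaches (initial coloring_algorithm (encode E r)) t ([::], m)].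
Proof.
set m0 := (initial coloring_algorithm (encode E r)).2.
have [t tb Rt] := @reaches_prog identity_prog [::] m0 isT.
exists (den identity_prog m0); split.
  pose P j (y : memory) := y 21 0 = j /\ forall v, v < j -> y 1 v = v.
  suff [] : P n (den identity_prog m0) by [].
  rewrite [den _ _]/=; apply: iteri_inv => [|j y jn [y21 y1]]; first by split.
  split=> // v; rewrite ltnS leq_eqVlt /update /= y21 => /predU1P[->|vj]; first by rewrite eqxx.
  by rewrite (ltn_eqF vj) y1.
exists (1 + t); first by have : t <= n * 4 + 3 := tb; lia.
apply: reaches_trans Rt; apply: reaches_step => _ /=.
by rewrite ifT // subn_eq0 addn1 -ltnNge ltnS.
Qed.

Lemma identity_safe N : safe (finished r E) N (initial coloring_algorithm (encode E r)).
Proof.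
have [m [mv [t _ Rt]]] := identity_run.
apply: safe_reaches Rt _; apply: safe_halted => //.
exists (widen_ord nr); split; first exact: identity_coloring.
by move=> v; rewrite [LHS]mv.
Qed.

Lemma identity_runtime T : (truncated_runtime R T (initial coloring_algorithm (encode E r)) <=
  (250 * 250 * n.+1 ^ 6)%:R)%R.
Proof.
have [m [_ [t tb Rt]]] := identity_run.
apply: le_trans (truncated_runtime_reaches R T Rt) _.
rewrite (_ : truncated_runtime R T ([::], m) = 0%R); last by case: (T).
rewrite addr0 ler_nat (leq_trans tb) //.
apply: (@leq_trans (7 * n.+1)); first by lia.
by apply: leq_mul; [lia | rewrite expnS leq_pmulr // expn_gt0].
Qed.

End FewVertices.

(** * From vertices numbered below n to an arbitrary finite vertex set *)

Section Transport.
Variables (V : finType) (E : {set {set V}}).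

Definition ranked_edges : {set {set 'I_#|V|}} :=
  [set [set enum_rank v | v in e]%SET | e : {set V} in E]%SET.

Let imI : injective (fun e : {set V} => [set enum_rank v | v in e]%SET).
Proof. exact/imset_inj/enum_rank_inj. Qed.

Lemma ranked_three_graph : three_graph E -> three_graph ranked_edges.
Proof.
move/forall_inP=> E3; apply/forall_inP=> _ /imsetP[e eE ->].
by rewrite card_imset ?E3 //; apply: enum_rank_inj.
Qed.

Lemma ranked_degree v : degree ranked_edges (enum_rank v) = degree E v.
Proof.
rewrite /degree -(card_imset _ imI); congr #|pred_of_set _|.
apply/setP=> e'; rewrite inE; apply/andP/imsetP => [[/imsetP[e eE ->] ve]|[e]].
  by exists e => //; rewrite inE eE -(mem_imset _ _ enum_rank_inj).
rewrite inE => /andP[eE ve] ->; split; first exact: imset_f.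
by rewrite mem_imset //; apply: enum_rank_inj.
Qed.

Lemma ranked_max_degree : max_degree ranked_edges = max_degree E.
Proof.
rewrite /max_degree (reindex (@enum_rank V)); last exact: onW_bij (enum_rank_bij _).
by apply: eq_bigr => v _; apply: ranked_degree.
Qed.

Lemma ranked_equitable r (f : 'I_#|V| -> 'I_r) :
  equitable_coloring ranked_edges f -> equitable_coloring E (f \o enum_rank).
Proof.
move=> [fp fe]; split.
  move=> e eE [c Hc]; apply: (fp [set enum_rank v | v in e]%SET); first exact: imset_f.
  by exists c => _ /imsetP[v ve ->]; apply: Hc.
move=> c; have := fe c; rewrite card_ord.
rewrite (_ : #|[set v | f v == c]| = #|[set v | (f \o enum_rank) v == c]|) //.
rewrite -(card_imset _ (@enum_rank_inj V)); congr #|pred_of_set _|.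
apply/setP=> i; rewrite inE; apply/idP/imsetP => [fi|[v]].
  by exists (enum_val i); rewrite ?inE /= enum_valK.
by rewrite inE => fv ->.
Qed.

End Transport.

Local Open Scope ring_scope.

Lemma algorithm_correct (R : realType) (d r : nat) : (2 <= d)%N ->
  10 ^+ 7 * Num.sqrt (d%:R : R) * ln (d%:R : R) ^+ 2 < r%:R ->
  forall (n : nat) (E : {set {set 'I_n}}), three_graph E -> max_degree E = d ->
  (forall coins : seq bool,
     halted (run (initial coloring_algorithm (encode E r)) coins) ->
     finished r E (run (initial coloring_algorithm (encode E r)) coins)) /\
  (expected_runtime R (initial coloring_algorithm (encode E r)) <=
    ((250 * 250 * n.+1 ^ 6)%N%:R)%:E)%E.
Proof.
move=> d2 hr n E /forall_inP E3 Ed.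
have {}E3 e : e \in E -> #|e| = 3%N by move=> /E3 /eqP.
have Edv v : (#|[set e in E | v \in e]| <= d)%N by rewrite -Ed /max_degree leq_bigmax.
have [nr|rn] := leqP n r.
  split=> [coins|]; first exact: (identity_safe nr E3 (leqnn _)).
  by apply: expected_runtime_le => T; apply: identity_runtime.
have [k [k0 kr rk dk]] := exponent_exists d2 hr.
split=> [coins|]; first exact: (algorithm_safe k0 rn kr rk E3 (leqnn _)).
by apply: expected_runtime_le => T; apply: (algorithm_runtime R k0 rn kr rk dk E3 Edv).
Qed.

Theorem theorem2 (R : realType) :
  (forall (d r : nat), (2 <= d)%N ->
     10 ^+ 7 * Num.sqrt (d%:R : R) * ln (d%:R : R) ^+ 2 < r%:R ->
     forall (V : finType) (E : {set {set V}}),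
       three_graph E -> max_degree E = d ->
       exists f : V -> 'I_r, equitable_coloring E f)
  /\
  (exists (A : cmd) (p : {poly nat}),
     forall (d r : nat), (2 <= d)%N ->
     10 ^+ 7 * Num.sqrt (d%:R : R) * ln (d%:R : R) ^+ 2 < r%:R ->
     forall (n : nat) (E : {set {set 'I_n}}),
       three_graph E -> max_degree E = d ->
       (forall coins : seq bool,
          halted (run (initial A (encode E r)) coins) ->
          exists f : 'I_n -> 'I_r,
            equitable_coloring E f /\
            outputs (run (initial A (encode E r)) coins) f)
       /\ (expected_runtime R (initial A (encode E r)) <= (p.[n]%:R)%:E)%E).
Proof.
split.
  move=> d r d2 hr V E E3 Ed.
  have Ed' : max_degree (ranked_edges E) = d by rewrite ranked_max_degree.
  have [sf ex] := algorithm_correct d2 hr (ranked_three_graph E3) Ed'.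
  (* Existence comes from the algorithm: a finite expected time yields a halting execution, whose
     output is a coloring. *)
  have [coins hc] := expected_runtime_halts (le_lt_trans ex (ltry _)).
  have [f [fe _]] := sf coins hc.
  by exists (f \o enum_rank); apply: ranked_equitable.
exists coloring_algorithm, ((250 * 250)%N%:P * ('X + 1%:P) ^+ 6).
move=> d r d2 hr n E E3 Ed.
have -> : ((250 * 250)%N%:P * ('X + 1%:P) ^+ 6).[n] = (250 * 250 * n.+1 ^ 6)%N.
  rewrite hornerM hornerC horner_exp hornerD hornerX hornerC.
  by rewrite (_ : (n + 1 = n.+1 :> nat)%R) ?natrXE //; apply: addn1.
exact: algorithm_correct d2 hr _ _ E3 Ed.
Qed.
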